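(* Let $\lambda>0$ and $0<\sigma<1$. Then for every $u\in H^\sigma_\lambda$, \[ Q_{\sigma,\lambda}\int_{-1}^{1}\frac{u^2(x)}{(1-x^2)^{\sigma/2}}\,d\mu_\lambda(x)\le \int_{-1}^{1}u(x)\,A_\sigma^\lambda u(x)\,d\mu_\lambda(x), \qquad\text{where}\quad Q_{\sigma,\lambda}=2^\sigma\frac{\Gamma\!\left(\frac{\lambda}{2}+\frac{1+\sigma}{4}\right)^2}{\Gamma\!\left(\frac{\lambda}{2}+\frac{1-\sigma}{4}\right)^2}. \]
   Context: For $\lambda>-1/2$ let $d\mu_\lambda(x)=(1-x^2)^{\lambda-1/2}\,dx$ on $(-1,1)$ and $L^2_\lambda=L^2((-1,1),d\mu_\lambda)$. Let $C_n^\lambda$ be the ultraspherical (Gegenbauer) polynomial of degree $n$ and order $\lambda$, and $c_n^\lambda=C_n^\lambda/\|C_n^\lambda\|_{L^2_\lambda}$, so $\{c_n^\lambda\}_{n\ge0}$ is an orthonormal basis of $L^2_\lambda$. For $f\in L^2_\lambda$ put $a_n^\lambda(f)=\int_{-1}^1 f(y)c_n^\lambda(y)\,d\mu_\lambda(y)$. For $\sigma>0$ the operator $A_\sigma^\lambda$ is defined spectrally by $A_\sigma^\lambda f=\sum_{n\ge0}\frac{\Gamma(n+\lambda+\frac{1+\sigma}{2})}{\Gamma(n+\lambda+\frac{1-\sigma}{2})}a_n^\lambda(f)c_n^\lambda$ (equivalently $A_\sigma^\lambda=\Gamma(\sqrt{-\mathcal L_\lambda}+\frac{1+\sigma}2)/\Gamma(\sqrt{-\mathcal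 L_\lambda}+\frac{1-\sigma}2)$ with $\mathcal L_\lambda=(1-x^2)\frac{d^2}{dx^2}-(2\lambda+1)x\frac{d}{dx}-\lambda^2$, which has $c_n^\lambda$ as eigenfunctions with eigenvalue $-(n+\lambda)^2$). The Sobolev space is $H^\sigma_\lambda=\{f\in L^2_\lambda:\sum_{n\ge0}(n+\lambda)^\sigma (a_n^\lambda(f))^2<\infty\}$. For $u\in H^\sigma_\lambda$, $\int_{-1}^1 u\,A_\sigma^\lambda u\,d\mu_\lambda$ means $\sum_{n\ge0}\frac{\Gamma(n+\lambda+\frac{1+\sigma}{2})}{\Gamma(n+\lambda+\frac{1-\sigma}{2})}(a_n^\lambda(u))^2$. *)

(* Defs.v *)
From HB Require Import structures.
From mathcomp Require Import all_boot all_order all_algebra.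
From mathcomp Require Import all_classical all_reals all_analysis.
Set Implicit Arguments. Unset Strict Implicit. Unset Printing Implicit Defensive.
Import Order.TTheory GRing.Theory Num.Theory.
Import numFieldNormedType.Exports.
Local Open Scope classical_set_scope.
Local Open Scope ring_scope.

Section Defs.
Variable R : realType.

Definition Gamma (s : R) : R :=
  fine (\int[lebesgue_measure]_(t in `]0%R, +oo[) (powR t (s - 1) * expR (- t))%:E)%E.

Definition weight (lam x : R) : R := powR (1 - x ^+ 2) (lam - 2^-1).

Definition muint (lam : R) (f : R -> R) : \bar R :=
  (\int[lebesgue_measure]_(x in `](-1)%R, 1%R[) (f x * weight lam x)%:E)%E.

(* Gegenbauer polynomials via the three-term recurrence:
   C_0 = 1, C_1 = 2 lam x,
   n C_n = 2 x (n + lam - 1) C_{n-1} - (n + 2 lam - 2) C_{n-2}.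
   gegen_pair lam n x = (C_n(x), C_{n+1}(x)). *)
Fixpoint gegen_pair (lam x : R) (n : nat) : R * R :=
  match n with
  | 0%N => (1, 2 * lam * x)
  | k.+1 =>
      let: (a, b) := gegen_pair lam x k in
      (* a = C_k, b = C_{k+1}; compute C_{k+2} with n = k+2 *)
      (b, (2 * x * (k.+2%:R + lam - 1) * b - (k.+2%:R + 2 * lam - 2) * a)
            / k.+2%:R)
  end.

Definition gegen (lam : R) (n : nat) (x : R) : R := (gegen_pair lam x n).1.

Definition gegen_norm (lam : R) (n : nat) : R :=
  Num.sqrt (fine (muint lam (fun x => gegen lam n x ^+ 2))).

Definition cgegen (lam : R) (n : nat) (x : R) : R := gegen lam n x / gegen_norm lam n.

Definition L2lam (lam : R) (u : R -> R) : Prop :=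
  measurable_fun (`](-1 : R), 1%R[ : set R) u /\ (muint lam (fun x => (u x ^+ 2)%R) < +oo)%E.

Definition coef (lam : R) (u : R -> R) (n : nat) : R :=
  fine (muint lam (fun y => u y * cgegen lam n y)).

Definition Hsob (sigma lam : R) (u : R -> R) : Prop :=
  L2lam lam u /\
  (\sum_(0 <= n <oo) (powR (n%:R + lam) sigma * coef lam u n ^+ 2)%:E < +oo)%E.

(* multiplier of A_sigma^lambda on c_n^lambda *)
Definition Amult (sigma lam : R) (n : nat) : R :=
  Gamma (n%:R + lam + (1 + sigma) / 2) / Gamma (n%:R + lam + (1 - sigma) / 2).

(* quadratic form int u A_sigma^lambda u dmu_lambda (series of nonnegative terms) *)
Definition Aform (sigma lam : R) (u : R -> R) : \bar R :=
  (\sum_(0 <= n <oo) (Amult sigma lam n * coef lam u n ^+ 2)%:E)%E.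

Definition Qconst (sigma lam : R) : R :=
  powR 2 sigma * (Gamma (lam / 2 + (1 + sigma) / 4) ^+ 2
                  / Gamma (lam / 2 + (1 - sigma) / 4) ^+ 2).

Definition hardy_lhs (sigma lam : R) (u : R -> R) : \bar R :=
  muint lam (fun x => u x ^+ 2 / powR (1 - x ^+ 2) (sigma / 2)).

End Defs.

(* Main.v *)
(** The inequality is a Schur test on Gegenbauer coefficients. The Hardy weight
    rho = (1 - x^2)^(- sigma / 2) is the increasing limit of polynomials rho_J in x^2 with
    nonnegative coefficients, and for lam > 0 multiplication by x maps C_n to a nonnegative
    combination of C_(n+1) and C_(n-1). So the matrix of multiplication by rho_J in the basis
    C_n has nonnegative entries. The test vector consists of the coefficients of
    w = (1 + x) (1 - x^2)^(- (2 lam + 1 - sigma) / 4). Integrating the derivative of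
    C_(n+1)(x) (1 - x^2)^(l + 1/2) gives a two-term recurrence for the integrals of C_n and x C_n
    against (1 - x^2)^(l - 1/2), hence the w_n are positive and, starting from the Beta integral,
    Q (rho w)_n <= (A_sigma multiplier)_n w_n. The factor 1 + x treats both parities at once.
    The Schur test yields the inequality with rho_J for polynomials; it extends to u by density
    of polynomials in L^2, and J tends to infinity by monotone convergence. *)

Require Import Defs.
From mathcomp Require Import all_boot all_order all_algebra.
From mathcomp Require Import all_classical all_reals all_analysis.
From mathcomp Require Import measurable_realfun ring lra zify.
Set Implicit Arguments. Unset Strict Implicit. Unset Printing Implicit Defensive.
Import Order.TTheory GRing.Theory Num.Theory.
Import numFieldNormedType.Exports.
Local Open Scope classical_set_scope.
Local Open Scope ring_scope.

(** * Improper integrals by exhaustion *)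

(** The exponent of w is borderline. Up to the factor (1 + x)^2, w^2 times the weight of order lam
    is (1 - x^2)^(sigma/2 - 1), which is integrable, while the extra Hardy factor turns it into (1 -
    x^2)^(-1), which is not: w is a ground state at which the left side just diverges. The even part
    w_0 of w satisfies A w_0 = Q rho w_0 coefficient by coefficient, and this is what fixes Q. But
    w_0 is orthogonal to every C_n with n odd, and a Schur test divides by the test vector; x w_0
    supplies the odd coefficients, at the price of an inequality there. The detour through rho_J has
    two reasons. Multiplication by a polynomial has finite rows in the basis C_n, so every Schur sum
    is finite. And u^2 rho is not known beforehand to be integrable, whereas rho_J is bounded on
    (-1, 1), so approximating u in L^2 controls the error. The delicate point is that C_n changes
    sign: rho_J <= rho alone does not compare the coefficients of rho_J w with those of rho w. *)

Lemma dominated_cvg_EFin d (T : measurableType d) (R : realType)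
    (mu : {measure set T -> \bar R}) (D : set T) (f_ : (T -> R)^nat) (f g : T -> R) :
  measurable D -> (forall n, measurable_fun D (f_ n)) -> measurable_fun D f ->
  (forall x, D x -> f_ n x @[n --> \oo] --> f x) ->
  mu.-integrable D (EFin \o g) ->
  (forall n x, D x -> `|f_ n x| <= g x) ->
  mu.-integrable D (EFin \o f) /\
  (\int[mu]_(x in D) (f_ n x)%:E @[n --> \oo] --> \int[mu]_(x in D) (f x)%:E)%E.
Proof.
move=> mD mf_ mf ff ig fg.
have [|||||? _ ?] := @dominated_convergence _ _ _ mu D mD
  (fun n => EFin \o f_ n) (EFin \o f) (EFin \o g); last by split.
- by move=> n; exact/measurable_EFinP.
- exact/measurable_EFinP.
- by apply: aeW => x Dx; apply: cvg_EFin; [exact: nearW|exact: ff].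
- exact: ig.
- by apply: aeW => x n Dx; rewrite /= lee_fin fg.
Qed.

Section integrable_real.
Context d (T : measurableType d) (R : realType).
Variables (mu : {measure set T -> \bar R}) (D : set T).
Hypothesis mD : measurable D.
Implicit Types f g : T -> R.

Lemma integrableZl_fun k f : mu.-integrable D (EFin \o f) ->
  mu.-integrable D (EFin \o (fun x => k * f x)).
Proof.
move=> h; have := integrableZl mD k h.
by apply: eq_integrable => // x _.
Qed.

Lemma integrableD_fun f g : mu.-integrable D (EFin \o f) ->
  mu.-integrable D (EFin \o g) -> mu.-integrable D (EFin \o (fun x => f x + g x)).
Proof.
move=> h1 h2; have := integrableD mD h1 h2.
by apply: eq_integrable => // x _.
Qed.

Lemma integrableB_fun f g : mu.-integrable D (EFin \o f) ->
  mu.-integrable D (EFin \o g) -> mu.-integrable D (EFin \o (fun x => f x - g x)).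
Proof.
move=> h1 h2; have := integrableB mD h1 h2.
by apply: eq_integrable => // x _.
Qed.

Lemma le_integrable_fun f g : measurable_fun D f ->
  (forall x, D x -> `|f x| <= g x) ->
  mu.-integrable D (EFin \o g) -> mu.-integrable D (EFin \o f).
Proof.
move=> mf fg ig; apply: le_integrable ig => //; first exact/measurable_EFinP.
by move=> x Dx; rewrite /= lee_fin (le_trans (fg _ Dx)) ?ler_norm.
Qed.

End integrable_real.

Section exhaustion.
Context {R : realType}.
Local Notation mu := (@lebesgue_measure R).
Implicit Types (a b : R^nat) (D E : set R) (f F G : R -> R).

(** Common frame for the half-line and for (-1, 1): calculus is done on the compact segments
    [[a n, b n]], and the integral over [D] is reached as a limit. *)
Definition exhausts a b D :=
  [/\ forall n, a n < b n, forall n, `[a n, b n]%classic `<=` D,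
      forall x, D x -> exists n, a n <= x <= b n,
      nonincreasing_seq a & nondecreasing_seq b].

Lemma exhausts_bigcup a b D : exhausts a b D -> \bigcup_n `[a n, b n]%classic = D.
Proof.
case=> _ sD cD _ _; apply/seteqP; split => [x [n _]|x /cD[n xn]].
  exact: sD.
by exists n => //=; rewrite in_itv.
Qed.

Lemma exhausts_nondecreasing a b D :
  exhausts a b D -> nondecreasing_seq (fun n => `[a n, b n]%classic).
Proof.
case=> _ _ _ ha hb m n mn; rewrite subsetEset => x /=; rewrite !in_itv/=.
by move=> /andP[ax xb]; rewrite (le_trans (ha _ _ mn) ax) (le_trans xb (hb _ _ mn)).
Qed.

Lemma exhausts_measurable a b D : exhausts a b D -> measurable D.
Proof. by move=> h; rewrite -(exhausts_bigcup h); exact: bigcup_measurable. Qed.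

Lemma exhausts_cvg_integral a b D (f : R -> \bar R) : exhausts a b D ->
  measurable_fun D f -> (forall x, D x -> 0 <= f x)%E ->
  (\int[mu]_(x in `[a n, b n]) f x @[n --> \oo] --> \int[mu]_(x in D) f x)%E.
Proof.
move=> h mf f0; have [_ sD _ _ _] := h; rewrite -(exhausts_bigcup h).
apply: ge0_nondecreasing_set_cvg_integral => //.
- exact: exhausts_nondecreasing h.
- by move=> n; apply: measurable_funS mf => //; exact: exhausts_measurable h.
- by move=> n x xn; apply: f0; exact: sD xn.
Qed.

Lemma FTC2_segment f F x y : x < y ->
  (forall t, `[x, y]%classic t -> {for t, continuous f}) ->
  (forall t, `[x, y]%classic t -> is_derive t 1 F (f t)) ->
  (\int[mu]_(t in `[x, y]) (f t)%:E = (F y - F x)%:E)%E.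
Proof.
move=> xy cf dF; rewrite EFinB.
have cF t : `[x, y]%classic t -> {for t, continuous F}.
  move=> h; apply: differentiable_continuous.
  by apply/derivable1_diffP; have [] := dF _ h.
apply: continuous_FTC2 => //.
- by apply: continuous_in_subspaceT => t /set_mem; exact: cf.
- split.
  + move=> t; rewrite in_itv/= => /andP[xt ty]; have [] // := dF t _.
    by rewrite /= in_itv/= !ltW.
  + by apply: cvg_at_right_filter; apply: cF; rewrite /= in_itv/= lexx ltW.
  + by apply: cvg_at_left_filter; apply: cF; rewrite /= in_itv/= lexx ltW.
- move=> t; rewrite in_itv/= => /andP[xt ty].
  rewrite derive1E; apply: derive_val; apply: dF.
  by rewrite /= in_itv/= !ltW.
Qed.

(** Integrability is a consequence here: for a nonnegative integrand, a bound on the increments of a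
    primitive bounds the integral by monotone convergence. *)
Lemma FTC2_exhaust_le a b D f F C : exhausts a b D -> measurable_fun D f ->
  (forall x, D x -> 0 <= f x) ->
  (forall x, D x -> {for x, continuous f}) ->
  (forall x, D x -> is_derive x 1 F (f x)) ->
  (forall n, F (b n) - F (a n) <= C) ->
  (\int[mu]_(x in D) (f x)%:E <= C%:E)%E.
Proof.
move=> h mf f0 cf dF FC.
have mfE : measurable_fun D (EFin \o f) by exact/measurable_EFinP.
have cvgf := exhausts_cvg_integral h mfE (fun x Dx => f0 x Dx : (0 <= (f x)%:E)%E).
rewrite -(cvg_lim _ cvgf)//; apply: lime_le.
  by apply/cvg_ex; eexists; exact: cvgf.
apply: nearW => n; case: h => ab sD _ _ _.
by rewrite /= (FTC2_segment (ab n) (fun t tn => cf t (sD n t tn))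
  (fun t tn => dF t (sD n t tn))) lee_fin.
Qed.

(** The integrand may change sign, so the limit is taken by dominated convergence of the truncations
    of [f] to the segments, with dominating function |f|. *)
Lemma FTC2_exhaust a b D f F (l1 l2 : R) : exhausts a b D ->
  mu.-integrable D (EFin \o f) ->
  (forall x, D x -> {for x, continuous f}) ->
  (forall x, D x -> is_derive x 1 F (f x)) ->
  F (a n) @[n --> \oo] --> l1 -> F (b n) @[n --> \oo] --> l2 ->
  (\int[mu]_(x in D) (f x)%:E = (l2 - l1)%:E)%E.
Proof.
move=> h intf cf dF Fa Fb.
have mD := exhausts_measurable h.
have [ab sD cD ha hb] := h.
have mf : measurable_fun D f by apply/measurable_EFinP; exact: measurable_int intf.
have [] := @dominated_cvg_EFin _ _ _ mu D (fun n => f \_ `[a n, b n]) f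
  (fun x => `|f x|) mD.
- move=> n; apply/(measurable_restrict f) => //.
  by apply: measurable_funS mf => // x [].
- exact: mf.
- move=> x Dx; apply: cvg_near_cst; have [N /andP[aN bN]] := cD _ Dx.
  near=> n; rewrite patchE ifT//; apply/mem_set; rewrite /= in_itv/=.
  apply/andP; split; [apply: le_trans (ha _ _ _) aN|apply: le_trans bN (hb _ _ _)];
  near: n; exact: nbhs_infty_ge.
- exact: (integrable_abse intf).
- by move=> n x Dx; rewrite patchE; case: ifPn => //= _; rewrite normr0.
move=> _ h1; apply: (cvg_unique _ h1) => //.
have -> : (fun n => \int[mu]_(x in D) ((f \_ `[a n, b n]) x)%:E)%E =
    (fun n => (F (b n) - F (a n))%:E).
  apply/funext => n; rewrite -(FTC2_segment (ab n) (fun t tn => cf t (sD n t tn))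
    (fun t tn => dF t (sD n t tn))).
  rewrite -[in RHS](setIidr (@sD n)) integral_mkcondr.
  by apply: eq_integral => x _; rewrite restrict_EFin.
by apply: cvg_EFin; [exact: nearW|exact: cvgB].
Unshelve. all: end_near. Qed.

(** The increasing map [F] carries the exhaustion of [D] to an exhaustion of [E]; substitution on
    each segment makes the two sequences of integrals equal term by term, hence also their
    limits. *)
Lemma ge0_substitution_exhaust a b D E F F' G : exhausts a b D ->
  measurable E -> is_interval E ->
  (forall x, D x -> E (F x)) -> (forall y, E y -> exists2 x, D x & F x = y) ->
  (forall x, D x -> is_derive x 1 F (F' x)) ->
  (forall x, D x -> {for x, continuous F'}) ->
  (forall x, D x -> 0 < F' x) ->
  (forall x y, D x -> D y -> x < y -> F x < F y) ->
  (forall y, E y -> {for y, continuous G}) ->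
  measurable_fun E G -> measurable_fun D (fun x => G (F x) * F' x) ->
  (forall y, E y -> 0 <= G y) ->
  (\int[mu]_(y in E) (G y)%:E = \int[mu]_(x in D) (G (F x) * F' x)%:E)%E.
Proof.
move=> h mE iE DE ED dF cF' F'0 Fi cG mG mGF G0.
have [ab sD cD ha hb] := h.
have Da n : D (a n) by apply: (sD n); rewrite /= in_itv/= lexx ltW.
have Db n : D (b n) by apply: (sD n); rewrite /= in_itv/= lexx ltW.
have Fle x y : D x -> D y -> x <= y -> F x <= F y.
  by move=> Dx Dy; rewrite le_eqVlt => /predU1P[->//|xy]; exact/ltW/Fi.
have h' : exhausts (F \o a) (F \o b) E.
  split.
  - by move=> n; exact: Fi.
  - move=> n y /=; rewrite in_itv/= => /andP[y1 y2].
    by apply: (iE (F (a n)) (F (b n))); [exact: DE|exact: DE|rewrite y1].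
  - move=> y /ED[x Dx <-]; have [n /andP[n1 n2]] := cD _ Dx.
    by exists n; rewrite /= !Fle.
  - by move=> m n mn; apply: Fle => //; exact: ha.
  - by move=> m n mn; apply: Fle => //; exact: hb.
have mGE : measurable_fun E (EFin \o G) by exact/measurable_EFinP.
have mGFE : measurable_fun D (EFin \o (fun x => G (F x) * F' x)).
  exact/measurable_EFinP.
have c1 := exhausts_cvg_integral h' mGE (fun y Ey => G0 y Ey : (0 <= (G y)%:E)%E).
have c2 := exhausts_cvg_integral h mGFE ltac:(by move=> x Dx /=;
  rewrite lee_fin mulr_ge0 ?(ltW (F'0 _ Dx))// G0//; exact: DE).
apply: (cvg_unique _ c1) => //; move: c2; apply: cvg_trans.
apply: near_eq_cvg; apply: nearW => n /=.
have cF x : D x -> {for x, continuous F}.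
  move=> Dx; apply: differentiable_continuous.
  by apply/derivable1_diffP; have [] := dF _ Dx.
have F'E x : D x -> (F^`())%classic x = F' x by move=> Dx; rewrite derive1E; apply: derive_val; exact: dF.
have Dab x : a n < x < b n -> D x.
  by move=> /andP[ax xb]; apply: (sD n); rewrite /= in_itv/= !ltW.
rewrite (@integration_by_substitution_increasing _ F G (a n) (b n) (ltW (ab n))).
- have mGFab : measurable_fun `]a n, b n[%classic (fun x => G (F x) * F' x).
    apply: measurable_funS mGF; first exact: exhausts_measurable h.
    by move=> x /=; rewrite in_itv/=; exact: Dab.
  apply: eq_integral_itv_bounded => //.
  + apply: eq_measurable_fun mGFab => x /set_mem/=; rewrite in_itv/= => /Dab Dx.
    by rewrite fctE F'E.
  + by move=> x; rewrite in_itv/= => /Dab Dx; rewrite /= fctE F'E.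
- move=> x y; rewrite !in_itv/= => /andP[x1 x2] /andP[y1 y2] xy.
  by apply: Fi => //; apply: (sD n); rewrite /= in_itv/= ?x1 ?y1.
- move=> x; rewrite in_itv/= => xab; have Dx := Dab _ xab.
  have := cF' _ Dx; rewrite /continuous_at/= F'E//; apply: cvg_trans.
  apply: near_eq_cvg; near=> y; rewrite F'E//; apply: Dab; near: y.
  by apply: near_in_itvoo; rewrite in_itv.
- apply/cvg_ex; exists (F' (a n)).
  apply: cvg_trans (cvg_at_right_filter (cF' _ (Da n))).
  apply: near_eq_cvg; near=> y; rewrite F'E//; apply: Dab; apply/andP; split => //.
- apply/cvg_ex; exists (F' (b n)).
  apply: cvg_trans (cvg_at_left_filter (cF' _ (Db n))).
  apply: near_eq_cvg; near=> y; rewrite F'E//; apply: Dab; apply/andP; split => //.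
- split.
  + by move=> x; rewrite in_itv/= => /Dab Dx; have [] := dF _ Dx.
  + by apply: cvg_at_right_filter; exact: cF.
  + by apply: cvg_at_left_filter; exact: cF.
- apply: continuous_in_subspaceT => y /set_mem /=; rewrite in_itv/= => y12.
  by apply: cG; apply: iE y12; exact: DE.
Unshelve. all: end_near. Qed.
End exhaustion.

(** * The Gamma function *)

Section gamma_function.
Context {R : realType}.
Local Notation mu := (@lebesgue_measure R).
Implicit Types (s t x z : R).

(** The shift by 2 keeps the first segment nondegenerate: with [n.+1] both endpoints would be 1 at n
    = 0. *)
Lemma exhausts_0y :
  exhausts (fun n => n.+2%:R^-1) (fun n => n.+2%:R) (`]0%R, +oo[%classic : set R).
Proof.
split.
- by move=> n; rewrite (@lt_trans _ _ 1)// ?invf_lt1 ?ltr1n ?ltr0n.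
- move=> n x /=; rewrite !in_itv/= andbT => /andP[+ _].
  by apply: lt_le_trans; rewrite invr_gt0 ltr0n.
- move=> x /=; rewrite in_itv/= andbT => x0.
  exists (maxn (Num.trunc x) (Num.trunc x^-1)); apply/andP; split.
    rewrite -[leRHS]invrK lef_pV2 ?posrE ?invr_gt0//.
    apply/ltW/(lt_le_trans (truncnS_gt _)).
    by rewrite ler_nat ltnS (leq_trans (leq_maxr _ _) (leqnSn _)).
  apply/ltW/(lt_le_trans (truncnS_gt _)).
  by rewrite ler_nat ltnS (leq_trans (leq_maxl _ _) (leqnSn _)).
- by move=> m n mn; rewrite lef_pV2 ?posrE ?ltr0n// ler_nat !ltnS.
- by move=> m n mn; rewrite ler_nat !ltnS.
Qed.

Lemma exhausts_N11 :
  exhausts (fun n => -1 + n.+2%:R^-1) (fun n => 1 - n.+2%:R^-1)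
    (`](-1)%R, 1%R[%classic : set R).
Proof.
have h0 n : 0 < n.+2%:R^-1 :> R by rewrite invr_gt0 ltr0n.
have h1 n : n.+2%:R^-1 < 1 :> R by rewrite invf_lt1 ?ltr1n ?ltr0n.
have [_ _ cD ha _] := exhausts_0y.
split.
- by move=> n; move: (h1 n) (h0 n); move: (_^-1) => i; lra.
- by move=> n x /=; rewrite !in_itv/=; move: (h0 n); move: (_^-1) => i; lra.
- move=> x /=; rewrite in_itv/= => /andP[x1 x2].
  (* The distance of x to the endpoints is a point of the half-line, so the previous exhaustion
     provides the index. *)
  have [|n /andP[n1 _]] := cD (1 - `|x|).
    by rewrite /= in_itv/= andbT subr_gt0 ltr_norml x1.
  exists n; move: n1; move: (_^-1) => i i1; have : `|x| <= 1 - i by lra.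
  by rewrite ler_norml; lra.
- by move=> m n mn; rewrite lerD2l; exact: ha.
- by move=> m n mn; rewrite lerD2l lerN2; exact: ha.
Qed.

Lemma is_derive_continuous (f : R -> R) x df :
  is_derive x 1 f df -> {for x, continuous f}.
Proof. by case=> h _; apply/differentiable_continuous/derivable1_diffP. Qed.

Lemma is_derive_powR_comp (g : R -> R) x dg p : 0 < g x -> is_derive x 1 g dg ->
  is_derive x 1 (fun y => g y `^ p) (p * g x `^ (p - 1) * dg).
Proof.
move=> gx dgx; have d := is_derive1_powR p gx.
exact: (@is_derive1_comp R (fun y => y `^ p) g x _ _ d dgx).
Qed.

Lemma gt0_powRD x p q : 0 < x -> x `^ (p + q) = x `^ p * x `^ q.
Proof. by move=> x0; rewrite powRD// (gt_eqF x0) implybT. Qed.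

Definition gammaf s t := t `^ (s - 1) * expR (- t).

Lemma gammaf_ge0 s t : 0 <= gammaf s t.
Proof. by rewrite mulr_ge0 ?powR_ge0 ?expR_ge0. Qed.

Lemma measurable_gammaf s : measurable_fun setT (gammaf s).
Proof.
by apply: measurable_funM => //; apply: measurableT_comp => //; exact: measurable_expR.
Qed.

Lemma is_derive_gammaf s t : 0 < t ->
  is_derive t 1 (gammaf s) ((s - 1) * gammaf (s - 1) t - gammaf s t).
Proof.
move=> t0; have d1 := is_derive1_powR (s - 1) t0.
have d2 : is_derive t 1 (fun y => expR (- y)) (- expR (- t)).
  have := @is_derive1_comp _ expR -%R t _ _ _ (is_deriveNid t 1).
  by move=> /(_ _ (is_derive_expR _)); rewrite mulrN1.
apply: (is_derive_eq (is_deriveM d1 d2)).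
by rewrite /gammaf /GRing.scale/=; ring.
Qed.

Lemma continuous_gammaf s t : 0 < t -> {for t, continuous (gammaf s)}.
Proof. by move=> t0; exact: is_derive_continuous (is_derive_gammaf s t0). Qed.

(** From 1 + t <= k (1 + t/k) <= k exp(t/k), raised to the power k. It trades the exponential for a
    power wherever the Gamma integrand needs a bound. *)
Lemma powR_le_expR k t : 1 <= k -> 0 <= t -> (1 + t) `^ k <= k `^ k * expR t.
Proof.
move=> k1 t0; have k0 : 0 < k by lra.
have kN : k != 0 by rewrite gt_eqF.
have h : 1 + t <= k * expR (t / k).
  apply: (@le_trans _ _ (k * (1 + t / k))).
    by rewrite mulrDr mulr1 mulrCA divff// mulr1 lerD2r.
  by rewrite ler_pM2l// expR_ge1Dx.
apply: (@le_trans _ _ ((k * expR (t / k)) `^ k)).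
  by rewrite ge0_ler_powR ?nnegrE//; [lra|lra|rewrite mulr_ge0 ?expR_ge0//; lra].
rewrite powRM ?expR_ge0//; last lra.
by rewrite -expRM divfK.
Qed.

(** The integrand is at most a constant times t^(s-1) (1 + t)^(-(s+1)), which has the explicit
    primitive (t / (1 + t))^s / s, bounded by 1/s. *)
Lemma gammaf_lty s : 0 < s ->
  (\int[mu]_(t in `]0%R, +oo[) (gammaf s t)%:E < +oo)%E.
Proof.
move=> s0.
pose f t := t `^ (s - 1) * (1 + t) `^ (- (s + 1)).
have f0 t : 0 <= f t by rewrite mulr_ge0 ?powR_ge0.
have mf : measurable_fun setT f.
  apply: measurable_funM => //.
  by apply: (measurableT_comp (measurable_powR _)) => //; exact: measurable_funD.
have dF t : 0 < t -> is_derive t 1 (fun t => s^-1 * (t `^ s * (1 + t) `^ (- s))) (f t).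
  move=> t0; have t1 : 0 < 1 + t by lra.
  have d1 := is_derive1_powR s t0.
  have d2 : is_derive t 1 (fun t => (1 + t) `^ (- s)) (- s * (1 + t) `^ (- s - 1) * 1).
    apply: is_derive_powR_comp => //; apply: is_derive_eq.
    by rewrite add0r.
  have d3 := is_deriveZ s^-1 (is_deriveM d1 d2).
  apply: (is_derive_eq d3); rewrite /f /GRing.scale/=.
  have -> : - (s + 1) = - s - 1 by ring.
  have -> : t `^ s = t * t `^ (s - 1) by rewrite mulr_powRB1// ltW.
  have -> : (1 + t) `^ (- s) = (1 + t) * (1 + t) `^ (- s - 1).
    by rewrite -{2}(powRr1 (ltW t1)) -powRD ?(gt_eqF t1) ?implybT//; congr powR; ring.
  by field; rewrite gt_eqF.
have cf t : 0 < t -> {for t, continuous f}.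
  move=> t0; have t1 : 0 < 1 + t by lra.
  apply: continuousM; first exact: is_derive_continuous (is_derive1_powR _ t0).
  have h : is_derive t 1 (fun t => 1 + t) 1 by apply: is_derive_eq; ring.
  exact: is_derive_continuous (is_derive_powR_comp _ t1 h).
have intf : (\int[mu]_(t in `]0%R, +oo[) (f t)%:E <= (s^-1)%:E)%E.
  apply: (FTC2_exhaust_le exhausts_0y (F := fun t => s^-1 * (t `^ s * (1 + t) `^ (- s)))).
  - exact: measurable_funTS.
  - by move=> t _.
  - by move=> t /=; rewrite in_itv/= andbT; exact: cf.
  - by move=> t /=; rewrite in_itv/= andbT; exact: dF.
  - move=> n; have n0 : 0 < n.+2%:R :> R by rewrite ltr0n.
    rewrite lerBlDr -[leLHS]addr0 lerD//; last first.
      by rewrite !mulr_ge0 ?powR_ge0// invr_ge0 ltW.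
    move: (n.+2%:R : R) n0 => N N0; have N1 : 0 < 1 + N by lra.
    rewrite ler_piMr ?invr_ge0 ?(ltW s0)// powRN ler_pdivrMr ?powR_gt0//.
    by rewrite mul1r ge0_ler_powR ?nnegrE ?(ltW s0) ?(ltW N0)//; lra.
apply: (@le_lt_trans _ _ (\int[mu]_(t in `]0%R, +oo[) (((s + 1) `^ (s + 1))%:E * (f t)%:E))%E).
  apply: ge0_le_integral => //.
  - by move=> t _; rewrite lee_fin gammaf_ge0.
  - by apply/measurable_EFinP; apply: measurable_funTS; exact: measurable_gammaf.
  - apply/measurable_EFinP; apply: measurable_funTS.
    by apply: measurable_funM.
  - move=> t /=; rewrite in_itv/= andbT => t0; rewrite -EFinM lee_fin /f /gammaf.
    have t1 : 0 < 1 + t by lra.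
    rewrite mulrCA ler_wpM2l ?powR_ge0// powRN ler_pdivlMr ?powR_gt0//.
    rewrite expRN mulrC ler_pdivrMr ?expR_gt0//.
    by apply: powR_le_expR; lra.
rewrite ge0_integralZl//.
- apply: (@le_lt_trans _ _ (((s + 1) `^ (s + 1))%:E * (s^-1)%:E)%E).
    by rewrite lee_wpmul2l// lee_fin powR_ge0.
  by rewrite -EFinM ltry.
- by apply/measurable_EFinP; exact: measurable_funTS.
- by move=> t _; rewrite lee_fin.
- by rewrite lee_fin powR_ge0.
Qed.

Lemma integrable_gammaf s : 0 < s -> mu.-integrable `]0%R, +oo[ (EFin \o gammaf s).
Proof.
move=> s0; apply/integrableP; split.
  by apply/measurable_EFinP; apply: measurable_funTS; exact: measurable_gammaf.
under eq_integral do rewrite /= ger0_norm ?gammaf_ge0//.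
exact: gammaf_lty.
Qed.

Lemma integral_gammaf s : 0 < s ->
  (\int[mu]_(t in `]0%R, +oo[) (gammaf s t)%:E = (Gamma s)%:E)%E.
Proof. by move=> s0; rewrite /Gamma fineK//; exact/integrable_fin_num/integrable_gammaf. Qed.

Lemma Gamma_gt0 s : 0 < s -> 0 < Gamma s.
Proof.
move=> s0; rewrite -lte_fin -integral_gammaf//.
(* On [1, 2] one has t^(s-1) = t^s / t >= 1/2 whatever the sign of s - 1, and exp(-t) >= exp(-2). *)
apply: (@lt_le_trans _ _ (\int[mu]_(t in `[1%R, 2%R]) (2^-1 * expR (- 2))%:E)%E).
  rewrite integral_cst//= lebesgue_measure_itv/= lte_fin ltr1n/= -EFinD -EFinM lte_fin.
  by rewrite !mulr_gt0 ?expR_gt0//; lra.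
apply: (@le_trans _ _ (\int[mu]_(t in `[1%R, 2%R]) (gammaf s t)%:E)%E).
  apply: ge0_le_integral => //.
  - by apply/measurable_EFinP; apply: measurable_funTS; exact: measurable_gammaf.
  - move=> t /=; rewrite in_itv/= => /andP[t1 t2]; rewrite lee_fin ler_pM ?expR_ge0//.
      have t0 : 0 < t by lra.
      rewrite powRB ?(gt_eqF t0) ?implybT// powRr1 ?(ltW t0)//.
      have ts : 1 <= t `^ s.
        have <- : (1 : R) `^ s = 1 by rewrite powR1.
        by rewrite ge0_ler_powR ?nnegrE ?(ltW s0) ?(ltW t0).
      rewrite -[leLHS]mul1r ler_pM// ?invr_ge0// lef_pV2 ?posrE//; lra.
    by rewrite ler_expR lerN2.
apply: ge0_subset_integral => //.
- by apply/measurable_EFinP; apply: measurable_funTS; exact: measurable_gammaf.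
- by move=> t _; rewrite lee_fin gammaf_ge0.
- by move=> t /=; rewrite !in_itv/= andbT => /andP[t1 _]; lra.
Qed.

Lemma cvg_inv_nat2 : (n.+2%:R^-1 : R) @[n --> \oo] --> 0.
Proof. by have := @cvg_harmonic R; rewrite -cvg_shiftS. Qed.

Lemma powR_seq_cvg0 s : 0 < s -> ((n.+2%:R^-1 : R) `^ s) @[n --> \oo] --> 0.
Proof.
move=> s0; have /cvg_at_rightP := powR_cvg0 s0; apply; split.
  by move=> n; rewrite invr_gt0 ltr0n.
exact: cvg_inv_nat2.
Qed.

(** Integration by parts as one total derivative: s [gammaf s] - [gammaf (s + 1)] is the derivative
    of t^s exp(-t), which tends to 0 at both ends. *)
Lemma GammaS s : 0 < s -> Gamma (s + 1) = s * Gamma s.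
Proof.
move=> s0; have s1 : 0 < s + 1 by lra.
have i1 := integrable_gammaf s1; have i0 := integrable_gammaf s0.
have i2 : mu.-integrable `]0%R, +oo[ (EFin \o (fun t => s * gammaf s t - gammaf (s + 1) t)).
  by apply: integrableB_fun => //; exact: integrableZl_fun.
have /eqP : (\int[mu]_(t in `]0%R, +oo[) (s * gammaf s t - gammaf (s + 1) t)%:E
    = (0 - 0)%:E)%E.
  apply: (FTC2_exhaust exhausts_0y (F := gammaf (s + 1))) => //.
  - move=> t /=; rewrite in_itv/= andbT => t0; apply: continuousB.
      by apply: continuousM; [exact: cvg_cst|exact: continuous_gammaf].
    exact: continuous_gammaf.
  - move=> t /=; rewrite in_itv/= andbT => t0.
    by apply: is_derive_eq (is_derive_gammaf _ t0) _; rewrite addrK.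
  - apply: squeeze_cvgr (cvg_cst 0) (powR_seq_cvg0 s0).
    apply: nearW => n; rewrite gammaf_ge0/= /gammaf addrK ler_piMr ?powR_ge0//.
  - have h : ((s + 1) `^ (s + 1) * n.+2%:R^-1) @[n --> \oo] --> ((s + 1) `^ (s + 1) * 0).
      by apply: cvgM; [exact: cvg_cst|exact: cvg_inv_nat2].
    rewrite mulr0 in h; apply: squeeze_cvgr (cvg_cst 0) h.
    apply: nearW => n; rewrite gammaf_ge0/= /gammaf addrK.
    have : 0 < n.+2%:R :> R by rewrite ltr0n.
    move: (n.+2%:R : R) => N N0.
    rewrite ler_pdivlMr// mulrAC expRN ler_pdivrMr ?expR_gt0//.
    have -> : N `^ s * N = N `^ (s + 1).
      by rewrite powRD ?(gt_eqF N0) ?implybT// powRr1 ?(ltW N0).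
    apply: (le_trans _ (powR_le_expR _ (ltW N0))); last lra.
    by rewrite ge0_ler_powR ?nnegrE; lra.
have -> : (\int[mu]_(t in `]0%R, +oo[) (s * gammaf s t - gammaf (s + 1) t)%:E =
   (s * Gamma s - Gamma (s + 1))%:E)%E.
  rewrite -[LHS]fineK; last exact: integrable_fin_num i2.
  congr EFin.
  by rewrite -/(Rintegral _ _ _) RintegralB// ?RintegralZl//; exact: integrableZl_fun.
by rewrite eqe subrr subr_eq0 => /eqP ->.
Qed.
End gamma_function.

(** * The Beta integral of (1 - x^2)^(z - 1) *)

Section beta_integral.
Context {R : realType}.
Local Notation mu := (@lebesgue_measure R).
Implicit Types (s t x z : R).

Lemma integral_gammaf_scale c s : 0 < c -> 0 < s ->
  (\int[mu]_(t in `]0%R, +oo[) (t `^ (s - 1) * expR (- (c * t)))%:E =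
   (c `^ (- s) * Gamma s)%:E)%E.
Proof.
move=> c0 s0.
have e1 : (\int[mu]_(t in `]0%R, +oo[) (gammaf s t)%:E =
           \int[mu]_(t in `]0%R, +oo[) (gammaf s (c * t) * c)%:E)%E.
  apply: (@ge0_substitution_exhaust _ _ _ _ _ (fun t => c * t) (cst c) _ exhausts_0y).
  - by [].
  - exact: interval_is_interval.
  - by move=> x /=; rewrite !in_itv/= !andbT => x0; rewrite mulr_gt0.
  - move=> y /=; rewrite !in_itv/= !andbT => y0; exists (c^-1 * y).
      by rewrite /= in_itv/= andbT mulr_gt0 ?invr_gt0.
    by rewrite mulrA divff ?mul1r// gt_eqF.
  - by move=> x _; apply: is_derive_eq; rewrite /GRing.scale/=; ring.
  - by move=> x _; exact: cst_continuous.
  - by [].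
  - by move=> x y _ _ xy; rewrite ltr_pM2l.
  - by move=> y /=; rewrite in_itv/= andbT => y0; exact: continuous_gammaf.
  - by apply: measurable_funTS; exact: measurable_gammaf.
  - apply: measurable_funTS; apply: measurable_funM => //.
    by apply: (measurableT_comp (measurable_gammaf s)); exact: measurable_funM.
  - by move=> y _; exact: gammaf_ge0.
have e2 : (\int[mu]_(t in `]0%R, +oo[) (gammaf s (c * t) * c)%:E =
  (c `^ s)%:E * \int[mu]_(t in `]0%R, +oo[) (t `^ (s - 1) * expR (- (c * t)))%:E)%E.
  rewrite -ge0_integralZl//.
  - apply: eq_integral => t /set_mem/=; rewrite in_itv/= andbT => t0.
    rewrite -EFinM /gammaf powRM ?ltW//; congr EFin.
    by rewrite -(mulr_powRB1 (ltW c0) s0); ring.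
  - apply/measurable_EFinP; apply: measurable_funTS; apply: measurable_funM => //.
    apply: (measurableT_comp (@measurable_expR R)).
    by apply: measurableT_comp => //; exact: measurable_funM.
  - by move=> t _; rewrite lee_fin mulr_ge0 ?powR_ge0 ?expR_ge0.
  - by rewrite lee_fin powR_ge0.
move: e1; rewrite integral_gammaf// e2 => h.
rewrite powRN EFinM h muleA -EFinM mulVf ?mul1e// gt_eqF// powR_gt0//.
Qed.

(** The increasing bijection (1 + x) / (1 - x) from (-1, 1) to the half-line. The inverse is written
    as a real power so that the derivative and measurability of [powR] apply directly. *)
Definition mobius x := (1 + x) * (1 - x) `^ (-1).
Definition dmobius x := 2 * (1 - x) `^ (- 2).

Lemma mobiusE x : x < 1 -> mobius x = (1 + x) / (1 - x).
Proof. by move=> x1; rewrite /mobius powR_inv1//; lra. Qed.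

Lemma is_derive_mobius x : x < 1 -> is_derive x 1 mobius (dmobius x).
Proof.
move=> x1; have y0 : 0 < 1 - x by lra.
have d1 : is_derive x 1 (fun x => 1 - x) (-1) by apply: is_derive_eq; ring.
have d2 : is_derive x 1 (fun x => 1 + x) 1 by apply: is_derive_eq; ring.
have d3 := @is_derive_powR_comp _ (fun x => 1 - x) x _ (-1) y0 d1.
have d4 := is_deriveM d2 d3.
apply: (is_derive_eq d4).
rewrite /GRing.scale/= /dmobius.
have -> : -1 - 1 = -2 :> R by ring.
have -> : (1 - x) `^ (-1) = (1 - x) * (1 - x) `^ (-2).
  rewrite -{2}(powRr1 (ltW y0)) -powRD ?(gt_eqF y0) ?implybT//; congr powR; lra.
by ring.
Qed.

Lemma integral_gammaf_mobius s z : 0 < s ->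
  (\int[mu]_(t in `]0%R, +oo[) (gammaf z t)%:E =
   \int[mu]_(x in `](-1)%R, 1%R[) (gammaf z (s * mobius x) * (s * dmobius x))%:E)%E.
Proof.
move=> s0.
have D x : x \in `](-1), 1[ -> (-1 < x < 1) by rewrite in_itv.
apply: (@ge0_substitution_exhaust _ _ _ _ _ (fun x => s * mobius x) _ _ exhausts_N11).
- by [].
- exact: interval_is_interval.
- move=> x /= /D /andP[x1 x2]; rewrite in_itv/= andbT mulr_gt0// mobiusE//.
  by rewrite divr_gt0//; lra.
- move=> y /=; rewrite !in_itv/= !andbT => y0.
  have y1 : 0 < y + s by lra.
  have h1 : (y - s) / (y + s) < 1 by rewrite ltr_pdivrMr//; lra.
  exists ((y - s) / (y + s)); first by rewrite /= in_itv/= h1 ltr_pdivlMr//; lra.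
  have n1 : y + s != 0 by rewrite gt_eqF.
  rewrite mobiusE//.
  have -> : 1 + (y - s) / (y + s) = 2 * y / (y + s) by field.
  have -> : 1 - (y - s) / (y + s) = 2 * s / (y + s) by field.
  by field; rewrite n1 gt_eqF.
- move=> x /= /D /andP[x1 x2].
  have d := is_derive_mobius x2.
  by apply: is_derive_eq (is_deriveZ s d) _.
- move=> x /= /D /andP[x1 x2]; have y0 : 0 < 1 - x by lra.
  have d1 : is_derive x 1 (fun x => 1 - x) (-1) by apply: is_derive_eq; ring.
  apply: continuousM; first exact: cst_continuous.
  apply: continuousM; first exact: cst_continuous.
  exact: is_derive_continuous (@is_derive_powR_comp _ (fun x => 1 - x) x _ (-2) y0 d1).
- move=> x /= /D /andP[x1 x2]; rewrite !mulr_gt0// powR_gt0//; lra.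
- move=> x y /= /D /andP[x1 x2] /D/andP[y1 y2] xy.
  rewrite ltr_pM2l// !mobiusE// ltr_pdivrMr; last lra.
  by rewrite mulrAC ltr_pdivlMr; nra.
- by move=> y /=; rewrite in_itv/= andbT => y0; exact: continuous_gammaf.
- by apply: measurable_funTS; exact: measurable_gammaf.
- apply: measurable_funTS; apply: measurable_funM.
    apply: (measurableT_comp (measurable_gammaf z)); apply: measurable_funM => //.
    apply: measurable_funM; first exact: measurable_funD.
    by apply: (measurableT_comp (measurable_powR _)); exact: measurable_funB.
  apply: measurable_funM => //; apply: measurable_funM => //.
  by apply: (measurableT_comp (measurable_powR _)); exact: measurable_funB.
- by move=> y _; exact: gammaf_ge0.
Qed.

Lemma tonelli_on (D E : set R) (h : R -> R -> R) : measurable D -> measurable E ->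
  measurable_fun setT (fun p : R * R => h p.1 p.2) -> (forall s x, 0 <= h s x) ->
  (\int[mu]_(s in D) \int[mu]_(x in E) (h s x)%:E =
   \int[mu]_(x in E) \int[mu]_(s in D) (h s x)%:E)%E.
Proof.
move=> mD mE mh h0.
pose k (p : R * R) := (\1_D p.1 * (\1_E p.2 * h p.1 p.2))%:E.
have mk : measurable_fun setT k.
  apply/measurable_EFinP; apply: measurable_funM.
    by apply: measurableT_comp => //; exact: measurable_indic.
  by apply: measurable_funM => //; apply: measurableT_comp => //; exact: measurable_indic.
have k0 p : (0 <= k p)%E by rewrite lee_fin !mulr_ge0.
have := fubini_tonelli (m1 := mu) (m2 := mu) k mk k0.
have restr (A : set R) (g : R -> R) :
    (\int[mu]_x (\1_A x * g x)%:E = \int[mu]_(x in A) (g x)%:E)%E.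
  rewrite [RHS]integral_mkcond; apply: eq_integral => x _.
  by rewrite patchE indicE; case: ifPn => _; rewrite ?mul1r ?mul0r.
have E1 s : (\int[mu]_x k (s, x) = ((fun s => \int[mu]_(x in E) (h s x)%:E) \_ D) s)%E.
  rewrite patchE /k/= indicE; case: ifPn => _ /=.
    by rewrite -(restr E (h s)); apply: eq_integral => x _; rewrite mul1r.
  by under eq_integral do rewrite mul0r; rewrite integral0.
have E2 x : (\int[mu]_s k (s, x) = ((fun x => \int[mu]_(s in D) (h s x)%:E) \_ E) x)%E.
  rewrite patchE /k/= (_ : \1_E x = (x \in E)%:R) ?indicE//; case: ifPn => _ /=.
    by rewrite -(restr D (h^~ x)); apply: eq_integral => s _; rewrite mul1r.
  by under eq_integral do rewrite mul0r mulr0; rewrite integral0.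
by under eq_integral do rewrite E1; under [X in _ = X -> _]eq_integral do rewrite E2;
  rewrite -!integral_mkcond.
Qed.

(** Write Gamma(z)^2 as a double integral in s and t and substitute t = s (1 + x) / (1 - x). Then s
    + t = 2 s / (1 - x), and by Tonelli the integral in s is a scaled Gamma(2 z); the remaining
    powers of 1 + x and 1 - x combine to 2^(1 - 2 z) (1 - x^2)^(z - 1). *)
Lemma integral_onem_sqr_powR z : 0 < z ->
  (\int[mu]_(x in `](-1)%R, 1%R[) ((1 - x ^+ 2) `^ (z - 1))%:E =
   (2 `^ (2 * z - 1) * (Gamma z ^+ 2 / Gamma (2 * z)))%:E)%E.
Proof.
move=> z0; have z20 : 0 < 2 * z by lra.
(* On the domain of integration the absolute value changes nothing; it makes [h] nonnegative on the
   whole plane, as [tonelli_on] asks. *)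
pose h s x := gammaf z s * (gammaf z (s * mobius x) * `|s * dmobius x|).
have mh : measurable_fun setT (fun p : R * R => h p.1 p.2).
  have m1 p : measurable_fun setT (fun q : R * R => (1 - q.2) `^ p).
    apply: (measurableT_comp (measurable_powR _)).
    by apply: measurable_funB.
  apply: measurable_funM; first exact: measurableT_comp (measurable_gammaf z) _.
  apply: measurable_funM.
    apply: (measurableT_comp (measurable_gammaf z)); apply: measurable_funM => //.
    by apply: measurable_funM => //; exact: measurable_funD.
  apply: measurableT_comp => //; apply: measurable_funM => //.
  exact: measurable_funM.
have h0 s x : 0 <= h s x.
  by apply: mulr_ge0; [|apply: mulr_ge0 => //]; exact: gammaf_ge0.
have := @tonelli_on `]0%R, +oo[ `](-1)%R, 1%R[ h ltac:(done) ltac:(done) mh h0.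
have -> : (\int[mu]_(s in `]0%R, +oo[) \int[mu]_(x in `](-1)%R, 1%R[) (h s x)%:E =
  (Gamma z ^+ 2)%:E)%E.
  transitivity (\int[mu]_(s in `]0%R, +oo[) ((gammaf z s)%:E * (Gamma z)%:E))%E.
    apply: eq_integral => s /set_mem/=; rewrite in_itv/= andbT => s0.
    rewrite -integral_gammaf// (integral_gammaf_mobius z s0) -ge0_integralZl//.
    - apply: eq_integral => x _; rewrite /h ger0_norm//.
      by rewrite !mulr_ge0 ?powR_ge0// ltW.
    - apply/measurable_EFinP/measurable_funTS/measurable_funM.
        apply: (measurableT_comp (measurable_gammaf z)); apply: measurable_funM => //.
        apply: measurable_funM; first exact: measurable_funD.
        by apply: (measurableT_comp (measurable_powR _)); exact: measurable_funB.
      apply: measurable_funM => //; apply: measurable_funM => //.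
      by apply: (measurableT_comp (measurable_powR _)); exact: measurable_funB.
    - by move=> x _; rewrite lee_fin !mulr_ge0 ?powR_ge0 ?gammaf_ge0// ltW.
    - by rewrite lee_fin gammaf_ge0.
  rewrite ge0_integralZr//.
  - by rewrite integral_gammaf// -EFinM expr2.
  - by apply/measurable_EFinP; apply: measurable_funTS; exact: measurable_gammaf.
  - by move=> t _; rewrite lee_fin gammaf_ge0.
  - by rewrite lee_fin ltW// Gamma_gt0.
have -> : (\int[mu]_(x in `](-1)%R, 1%R[) \int[mu]_(s in `]0%R, +oo[) (h s x)%:E =
  (2 `^ (1 - 2 * z) * Gamma (2 * z))%:E *
   \int[mu]_(x in `](-1)%R, 1%R[) ((1 - x ^+ 2) `^ (z - 1))%:E)%E.
  rewrite -ge0_integralZl//.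
  - apply: eq_integral => x /set_mem/=; rewrite in_itv/= => /andP[x1 x2].
    have y0 : 0 < 1 - x by lra.
    have c0 : 0 < 2 / (1 - x) by rewrite divr_gt0.
    have m0 : 0 < mobius x by rewrite mobiusE// divr_gt0//; lra.
    have d0 : 0 < dmobius x by rewrite mulr_gt0// powR_gt0.
    transitivity (\int[mu]_(s in `]0%R, +oo[) ((mobius x `^ (z - 1) * dmobius x)%:E *
        (s `^ (2 * z - 1) * expR (- (2 / (1 - x) * s)))%:E))%E.
      apply: eq_integral => s /set_mem/=; rewrite in_itv/= andbT => s0.
      rewrite /h -EFinM (gtr0_norm (mulr_gt0 s0 d0)) /gammaf.
      rewrite (powRM (z - 1) (ltW s0) (ltW m0)); congr EFin.
      have -> : s `^ (2 * z - 1) = s `^ (z - 1) * s `^ (z - 1) * s.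
        have -> : 2 * z - 1 = (z - 1) + (z - 1) + 1 by ring.
        by rewrite !(gt0_powRD _ _ s0) (powRr1 (ltW s0)).
      have -> : - (2 / (1 - x) * s) = - s + - (s * mobius x).
        by rewrite mobiusE//; field; rewrite gt_eqF.
      by rewrite expRD; ring.
    transitivity ((mobius x `^ (z - 1) * dmobius x)%:E *
        \int[mu]_(s in `]0%R, +oo[) (s `^ (2 * z - 1) * expR (- (2 / (1 - x) * s)))%:E)%E;
      [apply: ge0_integralZl => //|].
    + apply/measurable_EFinP; apply: measurable_funTS; apply: measurable_funM => //.
      apply: (measurableT_comp (@measurable_expR R)).
      by apply: measurableT_comp => //; exact: measurable_funM.
    + by move=> t _; rewrite lee_fin mulr_ge0 ?powR_ge0 ?expR_ge0.
    + by rewrite lee_fin mulr_ge0 ?powR_ge0// ltW.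
    + rewrite integral_gammaf_scale// -!EFinM; congr EFin.
      have -> : (1 - x ^+ 2) `^ (z - 1) = (1 + x) `^ (z - 1) * (1 - x) `^ (z - 1).
        by rewrite -powRM; [congr powR; ring|lra|lra].
      have -> : mobius x `^ (z - 1) = (1 + x) `^ (z - 1) * (1 - x) `^ (- (z - 1)).
        rewrite /mobius powRM; [|lra|exact: powR_ge0].
        by rewrite -powRrM mulN1r.
      have -> : (2 / (1 - x)) `^ (- (2 * z)) = 2 `^ (- (2 * z)) * (1 - x) `^ (2 * z).
        by rewrite powRM ?invr_ge0 ?(ltW y0)// -(powR_inv1 (ltW y0)) -powRrM mulN1r opprK.
      have -> : 2 `^ (1 - 2 * z) = 2 * 2 `^ (- (2 * z)) :> R.
        by rewrite gt0_powRD ?powRr1.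
      have -> : (1 - x) `^ (z - 1) =
          (1 - x) `^ (- (z - 1)) * (1 - x) `^ (- 2) * (1 - x) `^ (2 * z).
        by rewrite -!gt0_powRD//; congr powR; ring.
      by rewrite /dmobius; ring.
  - apply/measurable_EFinP/measurable_funTS.
    apply: (measurableT_comp (measurable_powR _)).
    by apply: measurable_funB => //; exact: measurable_funX.
  - by move=> x _; rewrite lee_fin powR_ge0.
  - by rewrite lee_fin mulr_ge0 ?powR_ge0// ltW// Gamma_gt0.
have c0 : 0 < 2 `^ (1 - 2 * z) * Gamma (2 * z) by rewrite mulr_gt0 ?powR_gt0 ?Gamma_gt0.
have -> : 2 `^ (2 * z - 1) * (Gamma z ^+ 2 / Gamma (2 * z)) =
    (2 `^ (1 - 2 * z) * Gamma (2 * z))^-1 * Gamma z ^+ 2.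
  have -> : 2 * z - 1 = - (1 - 2 * z) by ring.
  rewrite powRN; field; rewrite !gt_eqF ?powR_gt0 ?Gamma_gt0//.
by move=> e; rewrite EFinM e muleA -EFinM mulVf ?mul1e// gt_eqF.
Qed.
End beta_integral.

(** * Gegenbauer polynomials and weighted integrals *)

Section weighted_poly_integral.
Context {R : realType}.
Local Notation mu := (@lebesgue_measure R).
Local Notation I11 := (`](-1)%R, 1%R[%classic : set R).
Implicit Types (l x : R) (p q : {poly R}).

Lemma in_I11 x : I11 x -> 0 < 1 - x ^+ 2.
Proof. by rewrite /= in_itv/= => /andP[x1 x2]; nra. Qed.

Lemma measurable_weight l : measurable_fun setT (weight l).
Proof.
apply: (measurableT_comp (measurable_powR _)).
by apply: measurable_funB => //; exact: measurable_funX.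
Qed.

Lemma weight_ge0 l x : 0 <= weight l x.
Proof. exact: powR_ge0. Qed.

Lemma integral_weight l : - 2^-1 < l ->
  (\int[mu]_(x in I11) (weight l x)%:E =
   (2 `^ (2 * l) * (Gamma (l + 2^-1) ^+ 2 / Gamma (2 * l + 1)))%:E)%E.
Proof.
move=> hl; have z0 : 0 < l + 2^-1 by lra.
have := integral_onem_sqr_powR z0.
have -> : 2 * (l + 2^-1) - 1 = 2 * l by field.
have -> : 2 * (l + 2^-1) = 2 * l + 1 by field.
move=> <-; apply: eq_integral => x _; rewrite /weight; congr (EFin (_ `^ _)).
by field.
Qed.

Lemma integrable_weight l : - 2^-1 < l -> mu.-integrable I11 (EFin \o weight l).
Proof.
move=> hl; apply/integrableP; split.
  by apply/measurable_EFinP/measurable_funTS; exact: measurable_weight.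
under eq_integral do rewrite /= ger0_norm ?weight_ge0//.
by rewrite integral_weight// ltry.
Qed.

Lemma integrable_bounded_weight l (f : R -> R) M : - 2^-1 < l ->
  measurable_fun I11 f -> (forall x, I11 x -> `|f x| <= M) ->
  mu.-integrable I11 (EFin \o (fun x => f x * weight l x)).
Proof.
move=> hl mf fM; apply: (@le_integrable_fun _ _ _ mu _ _ _ (fun x => M * weight l x)) => //.
- by apply: measurable_funM => //; apply/measurable_funTS; exact: measurable_weight.
- by move=> x Ix; rewrite normrM (ger0_norm (weight_ge0 _ _)) ler_wpM2r ?weight_ge0 ?fM.
- by apply: integrableZl_fun => //; exact: integrable_weight.
Qed.

Definition poly_bound p := \sum_(i < size p) `|p`_i|.

Lemma poly_bound_ge0 p : 0 <= poly_bound p.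
Proof. exact: sumr_ge0. Qed.

Lemma horner_bound p x : `|x| <= 1 -> `|p.[x]| <= poly_bound p.
Proof.
move=> x1; rewrite horner_coef (le_trans (ler_norm_sum _ _ _))//.
apply: ler_sum => i _; rewrite normrM normrX ler_piMr// exprn_ile1//.
Qed.

Lemma horner_bound_I11 p x : I11 x -> `|p.[x]| <= poly_bound p.
Proof.
rewrite /= in_itv/= => /andP[x1 x2]; apply: horner_bound.
by rewrite ler_norml !ltW.
Qed.

Lemma continuous_horner_at p : continuous (horner p).
Proof. by move=> x; exact: is_derive_continuous (is_derive_poly p x). Qed.

Lemma measurable_horner p (D : set R) : measurable_fun D (horner p).
Proof.
apply/measurable_funTS; apply: continuous_measurable_fun; exact: continuous_horner_at.
Qed.

Lemma integrable_poly_weight l p : - 2^-1 < l ->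
  mu.-integrable I11 (EFin \o (fun x => p.[x] * weight l x)).
Proof.
move=> hl; apply: (@integrable_bounded_weight l (horner p) (poly_bound p)) => //.
  exact: measurable_horner.
by move=> x; exact: horner_bound_I11.
Qed.

(** The order [l] of the weight is independent of the order [lam] of the Gegenbauer polynomials: the
    same polynomials are integrated against the weights of orders [lam], [lground] and [lrho]. *)
Definition Lw l p : R := \int[mu]_(x in I11) (p.[x] * weight l x).

Lemma LwE l p : - 2^-1 < l -> muint l (horner p) = (Lw l p)%:E.
Proof. by move=> hl; rewrite /Lw /Rintegral fineK//; exact/integrable_fin_num/integrable_poly_weight. Qed.

Lemma Lw1 l : - 2^-1 < l ->
  Lw l 1 = 2 `^ (2 * l) * (Gamma (l + 2^-1) ^+ 2 / Gamma (2 * l + 1)).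
Proof.
move=> hl; apply: EFin_inj; rewrite -LwE// -integral_weight//.
by apply: eq_integral => x _; rewrite hornerC mul1r.
Qed.

Lemma LwD l p q : - 2^-1 < l -> Lw l (p + q) = Lw l p + Lw l q.
Proof.
move=> hl; rewrite /Lw -RintegralD//; try exact: integrable_poly_weight.
by apply: eq_Rintegral => x _; rewrite hornerD mulrDl.
Qed.

Lemma LwZ l c p : - 2^-1 < l -> Lw l (c *: p) = c * Lw l p.
Proof.
move=> hl; rewrite /Lw -RintegralZl//; last exact: integrable_poly_weight.
by apply: eq_Rintegral => x _; rewrite hornerZ mulrA.
Qed.

Lemma LwB l p q : - 2^-1 < l -> Lw l (p - q) = Lw l p - Lw l q.
Proof. by move=> hl; rewrite -scaleN1r LwD// LwZ// mulN1r. Qed.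

Lemma Lw_sum l n (F : nat -> {poly R}) : - 2^-1 < l ->
  Lw l (\sum_(i < n) F i) = \sum_(i < n) Lw l (F i).
Proof.
move=> hl; elim: n => [|n IH]; last by rewrite !big_ord_recr/= LwD// IH.
by rewrite !big_ord0 -(scale0r 0) LwZ// mul0r.
Qed.

Lemma Lw_ge0 l p : (forall x, I11 x -> 0 <= p.[x]) -> 0 <= Lw l p.
Proof. by move=> p0; apply: Rintegral_ge0 => x Ix; rewrite mulr_ge0 ?weight_ge0 ?p0. Qed.

Lemma Lw1_gt0 l : - 2^-1 < l -> 0 < Lw l 1.
Proof.
move=> hl; rewrite Lw1//; rewrite mulr_gt0 ?powR_gt0// divr_gt0 ?exprn_gt0 ?Gamma_gt0//; lra.
Qed.

(* The integrand is the derivative of p(x) (1 - x^2)^(l + 1/2), which vanishes at -1 and 1. *)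
Lemma Lw_deriv l p : - 2^-1 < l ->
  Lw l ((1 - 'X^2) * p^`() - (2 * l + 1) *: ('X * p)) = 0.
Proof.
move=> hl; have z0 : 0 < l + 2^-1 by lra.
set q := (X in Lw l X).
have e : (\int[mu]_(x in I11) (q.[x] * weight l x)%:E = (0 - 0)%:E)%E.
  pose F x := p.[x] * (1 - x ^+ 2) `^ (l + 2^-1).
  have dW x y : I11 x -> is_derive x 1 (fun x => (1 - x ^+ 2) `^ y)
      (y * (1 - x ^+ 2) `^ (y - 1) * (- (2 * x))).
    move=> Ix; apply: (@is_derive_powR_comp _ (fun x => 1 - x ^+ 2)).
      exact: in_I11.
    have d := is_derive_poly (1 - 'X^2) x.
    have -> : (fun x : R => 1 - x ^+ 2) = horner (1 - 'X^2).
      by apply/funext => y'; rewrite !hornerE.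
    apply: (is_derive_eq d).
    by rewrite derivB derivC derivXn sub0r hornerN hornerMn hornerXn/= mulr_natl.
  have lim0 (u : nat -> R) : (forall n, I11 (u n)) ->
      (forall n, 1 - u n ^+ 2 = n.+2%:R^-1 * (2 - n.+2%:R^-1)) ->
      F (u n) @[n --> \oo] --> 0.
    move=> Iu uE.
    have h : (poly_bound p * 2 `^ (l + 2^-1) * n.+2%:R^-1 `^ (l + 2^-1)) @[n --> \oo] --> 0.
      rewrite -[X in _ --> X](mulr0 (poly_bound p * 2 `^ (l + 2^-1))).
      by apply: cvgM; [exact: cvg_cst|exact: powR_seq_cvg0].
    apply/norm_cvg0P; apply: squeeze_cvgr (cvg_cst 0) h.
    apply: nearW => n; rewrite normr_ge0/= /F normrM -mulrA.
    rewrite ler_pM ?horner_bound_I11// ger0_norm ?powR_ge0//.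
    have i0 : 0 < n.+2%:R^-1 :> R by rewrite invr_gt0 ltr0n.
    have i1 : n.+2%:R^-1 <= 1 :> R by rewrite invf_le1 ?ler1n ?ltr0n.
    rewrite uE; move: (n.+2%:R^-1 : R) i0 i1 => i i0 i1.
    rewrite -powRM// ?(ltW i0)//.
    by rewrite ge0_ler_powR ?(ltW z0)// ?nnegrE; nra.
  have cf x : I11 x -> {for x, continuous (fun x => q.[x] * weight l x)}.
    move=> Ix; apply: continuousM; first exact: continuous_horner_at.
    exact: is_derive_continuous (dW _ _ Ix).
  have dF x : I11 x -> is_derive x 1 F (q.[x] * weight l x).
    move=> Ix; have d1 := is_derive_poly p x; have d2 := dW x (l + 2^-1) Ix.
    have d3 := is_deriveM d1 d2.
    apply: (is_derive_eq d3).
    rewrite /q !hornerE /weight /GRing.scale/=.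
    have -> : (1 - x ^+ 2) `^ (l + 2^-1) = (1 - x ^+ 2) * (1 - x ^+ 2) `^ (l - 2^-1).
      rewrite -{2}(powRr1 (ltW (in_I11 Ix))) -gt0_powRD ?in_I11//.
      by congr powR; field.
    have -> : l + 2^-1 - 1 = l - 2^-1 by field.
    by field.
  have [ab sD _ _ _] := @exhausts_N11 R.
  have la : F (-1 + n.+2%:R^-1) @[n --> \oo] --> 0.
    apply: lim0 => n; first by apply: (sD n); rewrite /= in_itv/= lexx ltW.
    by move: (n.+2%:R^-1 : R) => i; ring.
  have lb : F (1 - n.+2%:R^-1) @[n --> \oo] --> 0.
    apply: lim0 => n; first by apply: (sD n); rewrite /= in_itv/= lexx ltW.
    by move: (n.+2%:R^-1 : R) => i; ring.
  exact: (FTC2_exhaust exhausts_N11 (integrable_poly_weight q hl) cf dF la lb).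
by rewrite /Lw /Rintegral e/= subrr.
Qed.
End weighted_poly_integral.

(** * Gegenbauer polynomials: three-term recurrence and derivative formula *)

Section gegenbauer_poly.
Context {R : realType}.
Variable lam : R.
Hypothesis lam_gt0 : 0 < lam.
Implicit Types (x : R) (p q : {poly R}).

(** The recurrence of [gegen_pair] in {poly R}, where formal derivatives, sizes and coefficients are
    available; with n = k + 2, the factors n + lam - 1 and n + 2 lam - 2 are rewritten without
    subtraction. *)
Fixpoint gegenp_pair (n : nat) : {poly R} * {poly R} :=
  if n is k.+1 then
    let: (a, b) := gegenp_pair k in
    (b, (k.+2%:R)^-1 *: ((2 * (k.+1%:R + lam)) *: ('X * b) - (k%:R + 2 * lam) *: a))
  else (1, (2 * lam) *: 'X).

Definition gegenp n := (gegenp_pair n).1.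

Lemma gegenp0 : gegenp 0 = 1. Proof. by []. Qed.

Lemma gegenp1 : gegenp 1 = (2 * lam) *: 'X. Proof. by []. Qed.

Lemma gegenp_pairE n : gegenp_pair n = (gegenp n, gegenp n.+1).
Proof. by rewrite /gegenp /=; case: (gegenp_pair n). Qed.

Lemma gegenpSS n : gegenp n.+2 = (n.+2%:R)^-1 *:
  ((2 * (n.+1%:R + lam)) *: ('X * gegenp n.+1) - (n%:R + 2 * lam) *: gegenp n).
Proof. by rewrite {1}/gegenp /= gegenp_pairE /=. Qed.

Lemma horner_gegenp n x : (gegenp n).[x] = gegen lam n x.
Proof.
suff: ((gegenp n).[x], (gegenp n.+1).[x]) = gegen_pair lam x n.
  by rewrite /gegen => <-.
elim: n => [|n IH]; first by rewrite gegenp0 gegenp1 !hornerE.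
rewrite [RHS]/= -IH gegenpSS !(hornerZ, hornerD, hornerN, hornerM, hornerX); congr pair.
have nz : n.+2%:R != 0 :> R by rewrite pnatr_eq0.
move: nz; rewrite -[n.+2%:R]natr1 -[n.+1%:R]natr1 => nz; field.
exact: nz.
Qed.

(* Coefficients of gegenp n.+1 and gegenp n.-1 in 'X * gegenp n; gdown 0 = 0 because
   n.-1 truncates. *)
Definition gup n : R := n.+1%:R / (2 * (n%:R + lam)).
Definition gdown n : R := if n is k.+1 then (k%:R + 2 * lam) / (2 * (n%:R + lam)) else 0.

Lemma natrlam_gt0 n : 0 < n%:R + lam.
Proof. by rewrite ltr_wpDl. Qed.

Lemma gup_ge0 n : 0 <= gup n.
Proof. by rewrite divr_ge0 ?mulr_ge0// ltW// natrlam_gt0. Qed.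

Lemma gdown_ge0 n : 0 <= gdown n.
Proof.
case: n => //= n; rewrite divr_ge0 ?mulr_ge0//; last by rewrite ltW// natrlam_gt0.
by rewrite addr_ge0// mulr_ge0// ltW.
Qed.

Lemma mulX_gegenp n : 'X * gegenp n = gup n *: gegenp n.+1 + gdown n *: gegenp n.-1.
Proof.
have nl := natrlam_gt0 n; case: n nl => [|n] nl.
  rewrite gegenp0 gegenp1 mulr1 /= scale0r addr0 scalerA /gup.
  rewrite add0r div1r mulVf ?scale1r//.
  by rewrite gt_eqF// mulr_gt0.
rewrite /= gegenpSS !scalerBr !scalerA /gup.
have h1 : n.+2%:R != 0 :> R by rewrite pnatr_eq0.
have h2 : n.+1%:R + lam != 0 by rewrite gt_eqF.
move: (n.+2%:R : R) (n.+1%:R + lam) h1 h2 => A B A0 B0.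
have -> : A / (2 * B) / A * (2 * B) = 1 by field; rewrite A0 B0.
have -> : A / (2 * B) / A * (n%:R + 2 * lam) = (n%:R + 2 * lam) / (2 * B).
  by field; rewrite A0 B0.
by rewrite scale1r subrK.
Qed.

(** The differentiated recurrence expresses the derivative of C_(n+2) through those of C_(n+1) and
    C_n, so the induction carries two consecutive indices. *)
Lemma deriv_gegenp n : (1 - 'X^2) * (gegenp n.+1)^`() =
  (n%:R + 2 * lam) *: gegenp n - n.+1%:R *: ('X * gegenp n.+1).
Proof.
suff: (1 - 'X^2) * (gegenp n.+1)^`() =
    (n%:R + 2 * lam) *: gegenp n - n.+1%:R *: ('X * gegenp n.+1) /\
   (1 - 'X^2) * (gegenp n.+2)^`() =
    (n.+1%:R + 2 * lam) *: gegenp n.+1 - n.+2%:R *: ('X * gegenp n.+2) by case.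
have n2 k : k.+2%:R != 0 :> R by rewrite pnatr_eq0.
(* Scalars are turned into constant polynomials and the denominators k + 2 are cleared by [inj], so
   that the remaining identities are decided by [ring]. *)
have C2 c p : c *: p = c%:P * p by rewrite mul_polyC.
have rec k : k.+2%:R%:P * gegenp k.+2 =
    (2 * (k.+1%:R + lam))%:P * ('X * gegenp k.+1) - (k%:R + 2 * lam)%:P * gegenp k.
  by rewrite gegenpSS -!C2 scalerA divff// scale1r.
have drec k : k.+2%:R%:P * (gegenp k.+2)^`() =
    (2 * (k.+1%:R + lam))%:P * (gegenp k.+1 + 'X * (gegenp k.+1)^`())
     - (k%:R + 2 * lam)%:P * (gegenp k)^`().
  have := congr1 (@deriv R) (rec k).
  by rewrite !(derivM, derivB, derivC, derivX) !mul0r !add0r mul1r.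
have inj k p q : k.+2%:R%:P * p = k.+2%:R%:P * q -> p = q :> {poly R}.
  by rewrite -!C2; exact: scalerI.
elim: n => [|n [IH1 IH2]].
  have h1 : (gegenp 1)^`() = (2 * lam)%:P by rewrite gegenp1 derivZ derivX C2 mulr1.
  split.
    by rewrite h1 gegenp1 gegenp0 !C2 !mulr1 add0r; ring.
  apply: (inj 0); rewrite mulrCA drec h1 gegenp0 derivC mulr0 subr0 !C2.
  have -> : 2%:R%:P * ((1 + 2 * lam)%:P * gegenp 1 - 2%:R%:P * ('X * gegenp 2)) =
    2%:P * (1 + 2 * lam)%:P * gegenp 1 - 2%:P * 'X * (2%:R%:P * gegenp 2) by ring.
  by rewrite rec gegenp0 gegenp1 C2; ring.
split=> //; apply: (inj n.+1).
rewrite mulrCA drec; rewrite !C2 in IH1 IH2 *.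
have r0 := rec n; have r1 := rec n.+1.
have e1 : n.+1%:R = n%:R + 1 :> R by rewrite natr1.
have e2 : n.+2%:R = n%:R + 2 :> R by rewrite -natrD addn2.
have e3 : n.+3%:R = n%:R + 3 :> R by rewrite -natrD addn3.
rewrite e1 e2 ?e3 in IH1 IH2 r0 r1 *.
move: (n%:R : R) (gegenp n) (gegenp n.+1) (gegenp n.+2) (gegenp n.+3)
  IH1 IH2 r0 r1 => N G0 G1 G2 G3 IH1 IH2 r0 r1.
transitivity ((2 * (N + 2 + lam))%:P * ((1 - 'X^2) * G2 + 'X * ((1 - 'X^2) * G2^`()))
   - (N + 1 + 2 * lam)%:P * ((1 - 'X^2) * G1^`())); first by ring.
transitivity ((N + 3)%:P * (N + 2 + 2 * lam)%:P * G2 - (N + 3)%:P * 'X * ((N + 3)%:P * G3)); last by ring.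
have r0' : (N + 2 * lam)%:P * G0 = (2 * (N + 1 + lam))%:P * ('X * G1) - (N + 2)%:P * G2.
  by rewrite r0; ring.
by rewrite IH1 IH2 r0' r1; ring.
Qed.
End gegenbauer_poly.

(** * Multiplication matrices, step-two recurrence for the integrals, orthogonality *)

Section gegenbauer_integrals.
Context {R : realType}.
Variable lam : R.
Hypothesis lam_gt0 : 0 < lam.
Local Notation G := (gegenp lam).
Local Notation gup := (gup lam).
Local Notation gdown := (gdown lam).
Implicit Types (l : R) (p q : {poly R}).

(** Coefficient of C_m in x^k C_n, as a sum over nearest-neighbour walks of length k from n to m
    with weights [gup] and [gdown]. Nonnegativity and the vanishing when m is out of reach are
    visible in this form. *)
Fixpoint gmul (k n m : nat) : R :=
  if k is j.+1 then gup n * gmul j n.+1 m + gdown n * gmul j n.-1 m else (n == m)%:R.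

Lemma gmul_ge0 k n m : 0 <= gmul k n m.
Proof.
elim: k n => [|k IH] n //=.
by apply: addr_ge0; apply: mulr_ge0 => //; [exact: gup_ge0|exact: gdown_ge0].
Qed.

Lemma gmul_eq0 k n m : (m + k < n)%N -> gmul k n m = 0.
Proof.
elim: k n => [|k IH] n; first by rewrite addn0 /= => h; rewrite gtn_eqF.
case: n => // n; rewrite addnS ltnS => h /=.
by rewrite !IH ?mulr0 ?addr0//; lia.
Qed.

Lemma gmul_sum k n N : (n + k < N)%N ->
  'X^k * G n = \sum_(m < N) gmul k n m *: G m.
Proof.
elim: k n => [|k IH] n h.
  rewrite addn0 in h; rewrite expr0 mul1r (bigD1 (Ordinal h))//= eqxx scale1r big1 ?addr0//.
  by move=> i ni; rewrite (_ : (n == i) = false) ?scale0r//; apply/eqP => e; case/eqP: ni; exact: val_inj.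
rewrite exprSr -mulrA mulX_gegenp// mulrDr -!scalerAr.
rewrite (IH n.+1); last by rewrite addSnnS.
rewrite (IH n.-1); last by apply: leq_ltn_trans h; rewrite leq_add ?leq_pred.
rewrite !scaler_sumr -big_split/=; apply: eq_bigr => m _.
by rewrite !scalerA scalerDl.
Qed.

Definition gmulp q n m := \sum_(k < size q) q`_k * gmul k n m.

Lemma gmulp_ge0 q n m : (forall k, 0 <= q`_k) -> 0 <= gmulp q n m.
Proof. by move=> q0; apply: sumr_ge0 => k _; rewrite mulr_ge0 ?gmul_ge0. Qed.

Lemma gmulp_sum q n N : (n + size q <= N)%N ->
  q * G n = \sum_(m < N) gmulp q n m *: G m.
Proof.
move=> h; rewrite -{1}(coefK q) poly_def mulr_suml.
transitivity (\sum_(k < size q) \sum_(m < N) (q`_k * gmul k n m) *: G m).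
  apply: eq_bigr => k _; rewrite -scalerAl (@gmul_sum _ _ N).
    by rewrite scaler_sumr; apply: eq_bigr => m _; rewrite scalerA.
  by apply: leq_trans h; rewrite ltn_add2l.
by rewrite exchange_big/=; apply: eq_bigr => m _; rewrite scaler_suml.
Qed.

Lemma Lw_mulX_gegenp l n : - 2^-1 < l ->
  (n%:R + 2 + 2 * l) * Lw l ('X * G n.+1) = (n%:R + 2 * lam) * Lw l (G n).
Proof.
move=> hl; have := Lw_deriv (G n.+1) hl.
rewrite deriv_gegenp// LwB// LwB// !LwZ// -natr1 => h.
by lra.
Qed.

Lemma Lw_X l : - 2^-1 < l -> Lw l 'X = 0.
Proof.
move=> hl; have := Lw_deriv 1 hl.
rewrite derivC mulr0 mulr1 add0r -scaleNr LwZ// => /eqP.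
rewrite mulf_eq0 => /orP[/eqP|/eqP//]; lra.
Qed.

Lemma Lw_gegenp1 l : - 2^-1 < l -> Lw l (G 1) = 0.
Proof. by move=> hl; rewrite gegenp1 LwZ// Lw_X// mulr0. Qed.

(** Expand x C_(n+1) in [Lw_mulX_gegenp] by the three-term recurrence. The factor n + 2 lam - 2 l
    decides everything later: it vanishes at n = 0 for l = lam, which gives orthogonality to
    constants; it is positive for l < lam, which gives positivity; at [lground] and [lrho] it
    produces the ratios of the multiplier. *)
Lemma Lw_gegenpSS l n : - 2^-1 < l ->
  (n%:R + 2) * (n%:R + 2 + 2 * l) * Lw l (G n.+2) =
  (n%:R + 2 * lam) * (n%:R + 2 * lam - 2 * l) * Lw l (G n).
Proof.
move=> hl; have := Lw_mulX_gegenp n hl.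
rewrite mulX_gegenp// LwD// !LwZ//= /gup.
have := natrlam_gt0 lam_gt0 n.+1.
rewrite -[n.+2%:R]natr1 -![n.+1%:R]natr1; move: (n%:R : R) (Lw l _) (Lw l _) => N B A N0 h.
have /= := congr1 (fun z => z * (2 * (N + 1 + lam))) h.
have -> : (N + 2 + 2 * l) * ((N + 1 + 1) / (2 * (N + 1 + lam)) * A +
    (N + 2 * lam) / (2 * (N + 1 + lam)) * B) * (2 * (N + 1 + lam)) =
  (N + 2 + 2 * l) * ((N + 2) * A + (N + 2 * lam) * B).
  by field; rewrite gt_eqF.
by move=> h2; lra.
Qed.

Lemma half_lt_lam : - 2^-1 < lam. Proof. by have := lam_gt0; lra. Qed.

Lemma Lw_gegenp_eq0 n : Lw lam (G n.+1) = 0.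
Proof.
have hl := half_lt_lam.
suff: Lw lam (G n.+1) = 0 /\ Lw lam (G n.+2) = 0 by case.
elim: n => [|n [IH1 IH2]]; split => //; first exact: Lw_gegenp1.
  have := Lw_gegenpSS 0 hl; rewrite !add0r subrr mulr0 mul0r => /eqP.
  by rewrite !mulf_eq0 => /orP[/orP[/eqP|/eqP]|/eqP//]; have := lam_gt0; lra.
have := Lw_gegenpSS n.+1 hl; rewrite IH1 mulr0 => /eqP.
have N0 : 0 <= n.+1%:R :> R by [].
by rewrite !mulf_eq0 => /orP[/orP[/eqP|/eqP]|/eqP//]; have := lam_gt0; lra.
Qed.

(** Only the C_0 component of q C_n contributes to the integral, and a walk of length less than n
    starting at n cannot reach 0. *)
Lemma Lw_mul_gegenp_eq0 q n : (size q <= n)%N -> Lw lam (q * G n) = 0.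
Proof.
move=> h; have hl := half_lt_lam.
rewrite (@gmulp_sum _ _ (n + size q).+1)// (@Lw_sum _ _ _ (fun m => gmulp q n m *: G m))//.
rewrite big1// => -[[|m] hm] _ /=; rewrite LwZ// ?Lw_gegenp_eq0 ?mulr0//.
rewrite /gmulp big1 ?mul0r// => k _; rewrite gmul_eq0 ?mulr0//.
by rewrite add0n (leq_trans _ h).
Qed.

Lemma size_gegenp n : (size (G n) <= n.+1)%N.
Proof.
suff: (size (G n) <= n.+1)%N /\ (size (G n.+1) <= n.+2)%N by case.
elim: n => [|n [IH1 IH2]]; split => //.
- by rewrite gegenp0 size_poly1.
- by rewrite gegenp1 (leq_trans (size_scale_leq _ _))// size_polyX.
rewrite gegenpSS (leq_trans (size_scale_leq _ _))// (leq_trans (size_polyD _ _))// geq_max size_polyN.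
rewrite !(leq_trans (size_scale_leq _ _))//.
  by rewrite (leq_trans IH1)// ltnW.
by rewrite (leq_trans (size_polyMleq _ _))// size_polyX /= ltnS.
Qed.

Lemma gegenp_orthogonal n m : n != m -> Lw lam (G n * G m) = 0.
Proof.
wlog nm : n m / (n < m)%N => [hw|_].
  by rewrite neq_ltn => /orP[nm|mn]; [|rewrite mulrC]; rewrite hw ?ltn_eqF.
by rewrite Lw_mul_gegenp_eq0// (leq_trans (size_gegenp _)).
Qed.

Definition gnorm2 n := Lw lam (G n * G n).

(** Multiplying either C_n or C_(n+1) by x in the integral of x C_n C_(n+1) gives [gup n] times the
    norm at n + 1 and [gdown n.+1] times the norm at n; both factors are positive, so positivity
    propagates. *)
Lemma gnorm2_gt0 n : 0 < gnorm2 n.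
Proof.
have hl := half_lt_lam.
elim: n => [|n IH]; first by rewrite /gnorm2 gegenp0 mulr1 Lw1_gt0.
have e1 : Lw lam ('X * G n * G n.+1) = gup n * gnorm2 n.+1.
  have nS : n.-1 != n.+1 by lia.
  by rewrite mulX_gegenp// mulrDl LwD// -!(scalerAl _ (G _)) !LwZ// (gegenp_orthogonal nS) mulr0 addr0.
have e2 : Lw lam ('X * G n * G n.+1) = gdown n.+1 * gnorm2 n.
  have nS : n.+2 != n by lia.
  by rewrite mulrAC mulX_gegenp// mulrDl LwD// -!(scalerAl _ (G _)) !LwZ// (gegenp_orthogonal nS) mulr0 add0r.
have g0 : 0 < gup n by rewrite divr_gt0// ?mulr_gt0 ?natrlam_gt0// ltr0n.
have d0 : 0 < gdown n.+1.
  apply: divr_gt0; last by rewrite mulr_gt0// natrlam_gt0.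
  by apply: ltr_wpDl => //; exact: mulr_gt0.
by rewrite -(pmulr_rgt0 _ g0) -e1 e2 mulr_gt0.
Qed.

Lemma Lw_mul_gegenp2 q n m : Lw lam (q * G n * G m) = gmulp q n m * gnorm2 m.
Proof.
have hl := half_lt_lam.
have hN : (m < m + n + size q + 1)%N by lia.
have hq : (n + size q <= m + n + size q + 1)%N by lia.
rewrite (gmulp_sum hq).
rewrite mulr_suml; under eq_bigr do rewrite -scalerAl.
rewrite (@Lw_sum _ _ _ (fun i => gmulp q n i *: (G i * G m)))//.
rewrite (bigD1 (Ordinal hN))//= LwZ// big1 ?addr0// => i im.
rewrite LwZ// gegenp_orthogonal ?mulr0//.
Qed.
End gegenbauer_integrals.

(** * Ground state *)

Section ground_state.
Context {R : realType}.
Variables lam sigma : R.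
Hypotheses (lam_gt0 : 0 < lam) (sigma_gt0 : 0 < sigma) (sigma_lt1 : sigma < 1).
Local Notation G := (gegenp lam).
Implicit Types (l : R) (n : nat).

(** The step-two recurrence has positive factors for l < lam and starts from a positive value at 0
    and from 0 at 1. Strictness is confined to even n because the weight is even and C_n has the
    parity of n. *)
Lemma Lw_gegenp_sign l n : - 2^-1 < l -> l < lam ->
  0 <= Lw l (G n) /\ (~~ odd n -> 0 < Lw l (G n)).
Proof.
move=> hl hlam.
suff: (0 <= Lw l (G n) /\ (~~ odd n -> 0 < Lw l (G n))) /\
      (0 <= Lw l (G n.+1) /\ (~~ odd n.+1 -> 0 < Lw l (G n.+1))) by case.
elim: n => [|n [IH1 IH2]].
  rewrite gegenp0 Lw_gegenp1//; split; split => //; [|move=> _]; rewrite ?Lw1_gt0//.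
  by rewrite ltW// Lw1_gt0.
split=> //.
have := Lw_gegenpSS lam_gt0 n hl.
have N0 : 0 <= n%:R :> R by [].
set c := (n%:R + 2) * _; set d := (X in X * _ = _ -> _).
have c0 : 0 < (n%:R + 2) * (n%:R + 2 + 2 * l) by rewrite mulr_gt0; lra.
have d0 : 0 < (n%:R + 2 * lam) * (n%:R + 2 * lam - 2 * l).
  by have := lam_gt0 => ?; rewrite mulr_gt0; lra.
move=> e; rewrite /= negbK; split.
  by rewrite -(pmulr_rge0 _ c0) e mulr_ge0 ?(ltW d0)//; case: IH1.
move=> on; rewrite -(pmulr_rgt0 _ c0) e mulr_gt0//.
by case: IH1 => _; apply.
Qed.

(** At [lground] this is the integral of w C_n against the measure of order lam, and at [lrho] that
    of rho w C_n, both without the normalisation of C_n. *)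
Definition Uw l n := Lw l ((1 + 'X) * G n).

Lemma UwE l n : - 2^-1 < l -> Uw l n = Lw l (G n) + Lw l ('X * G n).
Proof. by move=> hl; rewrite /Uw mulrDl mul1r LwD. Qed.

Lemma Lw_mulX_ge0 l n : - 2^-1 < l -> l < lam ->
  0 <= Lw l ('X * G n) /\ (odd n -> 0 < Lw l ('X * G n)).
Proof.
move=> hl hlam; case: n => [|n].
  by rewrite gegenp0 mulr1 Lw_X.
have N0 : 0 <= n%:R :> R by [].
have [h1 h2] := Lw_gegenp_sign n hl hlam.
have c0 : 0 < n%:R + 2 + 2 * l by lra.
have d0 : 0 < n%:R + 2 * lam by have := lam_gt0; lra.
have e := Lw_mulX_gegenp lam n hl.
split; first by rewrite -(pmulr_rge0 _ c0) e mulr_ge0// ltW.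
by move=> /= /h2 h; rewrite -(pmulr_rgt0 _ c0) e mulr_gt0.
Qed.

Lemma Uw_gt0 l n : - 2^-1 < l -> l < lam -> 0 < Uw l n.
Proof.
move=> hl hlam; rewrite UwE//.
have [h1 h2] := Lw_gegenp_sign n hl hlam; have [h3 h4] := Lw_mulX_ge0 n hl hlam.
case: (boolP (odd n)) => on; first by have := h4 on; lra.
by have := h2 on; lra.
Qed.

(* With w(x) = (1 - x^2)^(- (2 lam + 1 - sigma) / 4), the weight of order lground is
   w times the weight of order lam, and that of order lrho is (1 - x^2)^(- sigma / 2) w times it. *)
Definition lground := (2 * lam - 1 + sigma) / 4.
Definition lrho := (2 * lam - 1 - sigma) / 4.

Lemma lground_gt : - 2^-1 < lground.
Proof. by rewrite /lground; have := lam_gt0; have := sigma_gt0; lra. Qed.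
Lemma lrho_gt : - 2^-1 < lrho.
Proof. by rewrite /lrho; have := lam_gt0; have := sigma_lt1; lra. Qed.
Lemma lground_lt : lground < lam.
Proof. by rewrite /lground; have := lam_gt0; have := sigma_lt1; lra. Qed.
Lemma Amult_gt0 n : 0 < Amult sigma lam n.
Proof.
have N0 : 0 <= n%:R :> R by [].
by rewrite divr_gt0// Gamma_gt0//; have := lam_gt0; have := sigma_gt0; have := sigma_lt1; lra.
Qed.

Lemma AmultS n : (n%:R + lam + (1 - sigma) / 2) * Amult sigma lam n.+1 =
  (n%:R + lam + (1 + sigma) / 2) * Amult sigma lam n.
Proof.
have N0 : 0 <= n%:R :> R by [].
have h1 : 0 < n%:R + lam + (1 + sigma) / 2 by have := lam_gt0; have := sigma_gt0; lra.
have h2 : 0 < n%:R + lam + (1 - sigma) / 2 by have := lam_gt0; have := sigma_lt1; lra.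
rewrite /Amult -[n.+1%:R]natr1.
have -> : n%:R + 1 + lam + (1 + sigma) / 2 = n%:R + lam + (1 + sigma) / 2 + 1 by ring.
have -> : n%:R + 1 + lam + (1 - sigma) / 2 = n%:R + lam + (1 - sigma) / 2 + 1 by ring.
rewrite !GammaS//.
have := Gamma_gt0 h1; have := Gamma_gt0 h2.
move: (Gamma _) (Gamma _) => g2 g1 g20 g10.
by field; rewrite !gt_eqF//; lra.
Qed.

Lemma Qconst_gt0 : 0 < Qconst sigma lam.
Proof.
have := lam_gt0; have := sigma_gt0; have := sigma_lt1 => ? ? ?.
by rewrite mulr_gt0 ?powR_gt0// divr_gt0 ?exprn_gt0// Gamma_gt0//; lra.
Qed.

(** The even part of w solves A w_0 = Q rho w_0 on coefficients. At n = 0 the multiplier replaces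
    Gamma(2 l + 1) at [lground] by its value at [lrho] in the Beta integral, and Q is exactly the
    remaining quotient. For the step put a = n + lam + (1 - sigma)/2 and a' = a + sigma: from n to n
    + 2 the quotient of the [lrho] integral by the [lground] integral is multiplied by a' (a' + 1) /
    (a (a + 1)), which is also the growth of the multiplier by [AmultS] used twice. *)
Lemma Lw_ground_eigen n :
  Qconst sigma lam * Lw lrho (G n) = Amult sigma lam n * Lw lground (G n).
Proof.
have h1 := lground_gt; have h2 := lrho_gt.
suff: Qconst sigma lam * Lw lrho (G n) = Amult sigma lam n * Lw lground (G n) /\
      Qconst sigma lam * Lw lrho (G n.+1) = Amult sigma lam n.+1 * Lw lground (G n.+1) by case.
elim: n => [|n [IH1 IH2]]; split; [| |exact: IH2|].
- rewrite gegenp0 (Lw1 h1) (Lw1 h2) /Qconst /Amult.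
  have -> : lam / 2 + (1 + sigma) / 4 = lground + 2^-1 by rewrite /lground; field.
  have -> : lam / 2 + (1 - sigma) / 4 = lrho + 2^-1 by rewrite /lrho; field.
  have -> : 0%:R + lam + (1 + sigma) / 2 = 2 * lground + 1 by rewrite /lground; field.
  have -> : 0%:R + lam + (1 - sigma) / 2 = 2 * lrho + 1 by rewrite /lrho; field.
  have -> : 2 `^ (2 * lground) = 2 `^ sigma * 2 `^ (2 * lrho) :> R.
    by rewrite -gt0_powRD//; congr powR; rewrite /lground /lrho; field.
  have : 0 < Gamma (lrho + 2^-1) by rewrite Gamma_gt0//; lra.
  have : 0 < Gamma (2 * lrho + 1) by rewrite Gamma_gt0//; lra.
  have : 0 < Gamma (2 * lground + 1) by rewrite Gamma_gt0//; lra.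
  move: (Gamma _) (Gamma _) (Gamma _) (Gamma _) (2 `^ _) (2 `^ _) => g1 g2 g3 g4 x y.
  by move=> p1 p2 p3; field; rewrite !gt_eqF.
- by rewrite !Lw_gegenp1// !mulr0.
have N0 : 0 <= n%:R :> R by [].
have := lam_gt0; have := sigma_gt0; have := sigma_lt1 => s1 s0 la.
have a0 : (n%:R + 2) * (n%:R + 1 + lam + (1 - sigma) / 2) != 0.
  rewrite gt_eqF; first by [].
  by apply: mulr_gt0; move: N0 s1 s0 la; clear; move: (n%:R : R) => N *; lra.
have e1 := Lw_gegenpSS lam_gt0 n h1; have e2 := Lw_gegenpSS lam_gt0 n h2.
have m0 := AmultS n; have m1 := AmultS n.+1.
have E1 : n%:R + 2 + 2 * lground = n%:R + 1 + lam + (1 + sigma) / 2 by rewrite /lground; field.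
have E2 : n%:R + 2 * lam - 2 * lground = n%:R + lam + (1 - sigma) / 2 by rewrite /lground; field.
have E3 : n%:R + 2 + 2 * lrho = n%:R + 1 + lam + (1 - sigma) / 2 by rewrite /lrho; field.
have E4 : n%:R + 2 * lam - 2 * lrho = n%:R + lam + (1 + sigma) / 2 by rewrite /lrho; field.
apply: (mulfI a0); rewrite E1 E2 in e1; rewrite E3 E4 in e2; rewrite -[n.+1%:R]natr1 in m1.
transitivity (Qconst sigma lam * ((n%:R + 2) * (n%:R + 1 + lam + (1 - sigma) / 2) *
  Lw lrho (G n.+2))); first by ring.
rewrite e2.
transitivity ((n%:R + 2 * lam) * (n%:R + lam + (1 + sigma) / 2) *
  (Qconst sigma lam * Lw lrho (G n))); first by ring.
rewrite IH1.
transitivity ((n%:R + 2 * lam) * Lw lground (G n) *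
  ((n%:R + lam + (1 + sigma) / 2) * Amult sigma lam n)); first by ring.
rewrite -m0.
transitivity ((n%:R + 2 * lam) * (n%:R + lam + (1 - sigma) / 2) * Lw lground (G n) *
  Amult sigma lam n.+1); first by ring.
rewrite -e1.
transitivity ((n%:R + 2) * Lw lground (G n.+2) *
  ((n%:R + 1 + lam + (1 + sigma) / 2) * Amult sigma lam n.+1)); first by ring.
by rewrite -m1; ring.
Qed.

(* Equality for even n; for odd n the inequality is (b + 1 + sigma) / (b + 1) <= (b + sigma) / b. *)
Lemma Uw_ground_super n :
  Qconst sigma lam * Uw lrho n <= Amult sigma lam n * Uw lground n.
Proof.
have h1 := lground_gt; have h2 := lrho_gt.
rewrite !UwE// !mulrDr Lw_ground_eigen lerD2l; case: n => [|n].
  by rewrite gegenp0 mulr1 !Lw_X// !mulr0.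
have N0 : 0 <= n%:R :> R by [].
have := lam_gt0; have := sigma_gt0; have := sigma_lt1 => s1 s0 la.
have e1 := Lw_mulX_gegenp lam n h1; have e2 := Lw_mulX_gegenp lam n h2.
have m0 := AmultS n; have M0 := Amult_gt0 n; have IH := Lw_ground_eigen n.
have [V0 _] := Lw_mulX_ge0 n.+1 h1 lground_lt.
set b := n%:R + lam + (1 - sigma) / 2 in m0.
have b0 : 0 < b.
  by rewrite /b; move: N0 s1 s0 la; clear; move: (n%:R : R) => N *; lra.
have E1 : n%:R + 2 + 2 * lground = b + 1 + sigma by rewrite /lground /b; field.
have E3 : n%:R + 2 + 2 * lrho = b + 1 by rewrite /lrho /b; field.
have E5 : n%:R + lam + (1 + sigma) / 2 = b + sigma by rewrite /b; field.
rewrite E1 in e1; rewrite E3 in e2; rewrite E5 in m0.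
move: V0 e1 e2 m0 M0 IH.
move: (Lw lground ('X * _)) (Lw lrho ('X * _)) (Lw lground (G n)) (Lw lrho (G n)) => V1 V2 W1 W2.
move: (Amult _ _ n) (Amult _ _ n.+1) (Qconst _ _) => M M' Q V0 e1 e2 m0 M0 IH.
have bb : 0 < b * (b + 1) by rewrite mulr_gt0//; lra.
rewrite -(ler_pM2l bb).
have -> : b * (b + 1) * (Q * V2) = b * (b + 1 + sigma) * (M * V1).
  transitivity (b * Q * ((b + 1) * V2)); first by ring.
  rewrite e2; transitivity (b * (n%:R + 2 * lam) * (Q * W2)); first by ring.
  rewrite IH; transitivity (b * M * ((n%:R + 2 * lam) * W1)); first by ring.
  by rewrite -e1; ring.
have -> : b * (b + 1) * (M' * V1) = (b + 1) * (b + sigma) * (M * V1).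
  transitivity ((b + 1) * V1 * (b * M')); first by ring.
  by rewrite m0; ring.
by rewrite ler_wpM2r ?mulr_ge0 ?(ltW M0)//; nra.
Qed.

End ground_state.

(** * Binomial series of the Hardy weight *)

Section binomial_series.
Context {R : realType}.
Variable s : R.
Hypotheses (s_gt0 : 0 < s) (s_le1 : s <= 1).
Implicit Types (x y : R) (J : nat).

(** Taylor coefficients of (1 - y)^(-s) at 0. *)
Fixpoint bincoef (j : nat) : R :=
  if j is k.+1 then bincoef k * ((s + k%:R) / k.+1%:R) else 1.

Lemma bincoef_ge0 j : 0 <= bincoef j.
Proof.
elim: j => //= j IH; rewrite mulr_ge0// divr_ge0// addr_ge0// ltW//.
Qed.

Lemma bincoef_le1 j : bincoef j <= 1.
Proof.
elim: j => //= j IH; rewrite mulr_ile1// ?bincoef_ge0//.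
  by rewrite divr_ge0// addr_ge0// ltW.
by rewrite ler_pdivrMr ?ltr0n// mul1r -natr1 addrC lerD2l.
Qed.

Lemma bincoefS j : j.+1%:R * bincoef j.+1 = (s + j%:R) * bincoef j.
Proof. by rewrite /= mulrCA [X in _ * X]mulrC divfK ?pnatr_eq0// mulrC. Qed.

Definition binpoly J : {poly R} := \sum_(j < J.+1) bincoef j *: 'X^j.

Lemma binpolyS J : binpoly J.+1 = binpoly J + bincoef J.+1 *: 'X^(J.+1).
Proof. by rewrite /binpoly big_ord_recr. Qed.

(** Truncation of the equation (1 - y) f' = s f solved by (1 - y)^(-s): the recurrence of the
    coefficients cancels all terms but the one of top degree. *)
Lemma deriv_binpoly J :
  (1 - 'X) * (binpoly J)^`() = s *: binpoly J - ((s + J%:R) * bincoef J) *: 'X^J.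
Proof.
elim: J => [|J IH].
  rewrite /binpoly big_ord1 /= scale1r expr0 derivC mulr0 addr0 mulr1 subrr//.
rewrite binpolyS derivD mulrDr IH derivZ derivXn -bincoefS [J.+1.-1]/=.
have -> : 'X^J *+ J.+1 = J.+1%:R%:P * 'X^J :> {poly R} by rewrite polyC_natr mulr_natl.
rewrite exprS -!mul_polyC -[J.+1%:R]natr1.
by move: (bincoef J.+1) => c; ring.
Qed.

(* Mean value theorem for binpoly(y) (1 - y)^s, whose derivative is
   - (s + J) b_J y^J (1 - y)^(s - 1) by deriv_binpoly. *)
Lemma binpoly_defect J y : 0 <= y -> y < 1 ->
  0 <= 1 - (binpoly J).[y] * (1 - y) `^ s <= J.+1%:R * y ^+ J * (1 - y) `^ (s - 1).
Proof.
move=> y0 y1.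
have p0 : (binpoly J).[0] = 1.
  elim: J => [|J IH]; first by rewrite /binpoly big_ord1 /= scale1r expr0 hornerC.
  by rewrite binpolyS hornerD IH hornerZ hornerXn expr0n /= mulr0 addr0.
move: y0; rewrite le_eqVlt => /predU1P[<-|y0].
  by rewrite p0 subr0 powR1 !mulr1 subrr lexx/= mulr_ge0// exprn_ge0.
pose g y := (binpoly J).[y] * (1 - y) `^ s.
pose dg y := - ((s + J%:R) * bincoef J * y ^+ J * (1 - y) `^ (s - 1)).
have dgP (z : R) : z < 1 -> is_derive z 1 g (dg z).
  move=> z1; have w0 : 0 < 1 - z by lra.
  have d1 : is_derive z 1 (fun x => 1 - x) (-1) by apply: is_derive_eq; ring.
  have d2 := @is_derive_powR_comp _ (fun x => 1 - x) z _ s w0 d1.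
  have d3 := is_deriveM (is_derive_poly (binpoly J) z) d2.
  apply: (is_derive_eq d3); rewrite /dg /GRing.scale/=.
  have := congr1 (fun p => p.[z]) (deriv_binpoly J).
  rewrite /= !(hornerM, hornerD, hornerN, hornerZ, hornerC, hornerX, hornerXn) => e.
  have -> : (1 - z) `^ s = (1 - z) * (1 - z) `^ (s - 1).
    by rewrite mulr_powRB1// ltW.
  transitivity ((1 - z) `^ (s - 1) * ((1 - z) * (binpoly J)^`().[z] - s * (binpoly J).[z]));
    first by ring.
  by rewrite e; ring.
have cg : {within `[0, y], continuous g}.
  apply: continuous_in_subspaceT => z /set_mem/=; rewrite in_itv/= => /andP[z0 zy].
  by apply: is_derive_continuous (dgP z _); lra.
have [c cy e] := MVT y0 (fun z zy => dgP z ltac:(by move: zy; rewrite in_itv/= => /andP[_ ?]; lra)) cg.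
move: cy; rewrite in_itv/= => /andP[c0 cy].
have g0 : g 0 = 1 by rewrite /g p0 subr0 powR1 mulr1.
have -> : 1 - (binpoly J).[y] * (1 - y) `^ s = - (dg c * y).
  by move: e; rewrite g0 subr0 => <-; rewrite opprB.
have [b0 b1] := (bincoef_ge0 J, bincoef_le1 J).
have N0 : 0 <= J%:R :> R by [].
have cJ : 0 <= c ^+ J by rewrite exprn_ge0// ltW.
rewrite /dg mulNr opprK; apply/andP; split.
  by rewrite !mulr_ge0 ?powR_ge0 ?addr_ge0 ?(ltW s_gt0) ?(ltW y0).
rewrite -[leRHS]mulr1 ler_pM ?(ltW y0) ?(ltW y1)//.
  by rewrite !mulr_ge0 ?powR_ge0 ?addr_ge0 ?(ltW s_gt0).
rewrite ler_pM ?powR_ge0//.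
- by rewrite !mulr_ge0 ?addr_ge0 ?(ltW s_gt0).
- rewrite ler_pM//; first by rewrite !mulr_ge0 ?addr_ge0 ?(ltW s_gt0).
    rewrite -[leRHS]mulr1 ler_pM ?addr_ge0 ?(ltW s_gt0)//.
    by rewrite -natr1 addrC lerD2l.
  by rewrite lerXn2r ?nnegrE ?(ltW c0) ?(ltW y0) ?(ltW cy).
have w0 : 0 < 1 - y by lra.
have w1 : 0 < 1 - c by lra.
have -> : s - 1 = - (1 - s) by ring.
rewrite !powRN lef_pV2 ?posrE ?powR_gt0//.
by apply: ge0_ler_powR; rewrite ?nnegrE ?subr_ge0 ?(ltW w0) ?(ltW w1) ?lerD2l ?lerN2 ?(ltW cy)
  ?(ltW y1) ?(le_trans (ltW cy) (ltW y1)).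
Qed.

(** With t the square root of y, (n + 1) t^n <= 1 + t + ... + t^n <= 1 / (1 - t), so the sequence is
    at most t^n / (1 - t). *)
Lemma cvg_nat_geometric y : 0 <= y -> y < 1 -> (n.+1%:R * y ^+ n) @[n --> \oo] --> 0.
Proof.
move=> y0 y1; set t := Num.sqrt y.
have t0 : 0 <= t by exact: sqrtr_ge0.
have t1 : t < 1 by rewrite -sqrtr1 ltr_sqrt.
have yE : y = t * t by rewrite -expr2 sqr_sqrtr.
have h : (t ^+ n * (1 - t)^-1) @[n --> \oo] --> 0 * (1 - t)^-1.
  by apply: cvgM; [apply: cvg_expr; rewrite ger0_norm|exact: cvg_cst].
rewrite mul0r in h; apply: squeeze_cvgr (cvg_cst 0) h.
apply: nearW => n; rewrite mulr_ge0 ?exprn_ge0//=.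
rewrite yE exprMn mulrA mulrC ler_wpM2l ?exprn_ge0// -[leRHS]mul1r ler_pdivlMr ?subr_gt0//.
apply: (@le_trans _ _ ((\sum_(i < n.+1) t ^+ i) * (1 - t))).
  have -> : n.+1%:R * t ^+ n = \sum_(i < n.+1) t ^+ n by rewrite sumr_const card_ord mulr_natl.
  rewrite ler_wpM2r ?subr_ge0 ?(ltW t1)//; apply: ler_sum => i _.
  by rewrite ler_wiXn2l ?(ltW t1)// -ltnS.
have := subrX1 t n.+1; have := exprn_ge0 n.+1 t0.
move: (t ^+ _) (\sum_(i < _) _) => a b a0 e; lra.
Qed.

End binomial_series.

(** * Even polynomials increasing to the Hardy weight *)

Section rho_polynomials.
Context {R : realType}.
Variable s : R.
Hypotheses (s_gt0 : 0 < s) (s_le1 : s <= 1).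
Local Notation I11 := (`](-1)%R, 1%R[%classic : set R).
Implicit Types (x : R) (J : nat).

Definition rhop J : {poly R} := \sum_(j < J.+1) bincoef s j *: 'X^(j.*2).

Lemma rhopS J : rhop J.+1 = rhop J + bincoef s J.+1 *: 'X^(J.+1.*2).
Proof. by rewrite /rhop big_ord_recr. Qed.

Lemma horner_rhop J x : (rhop J).[x] = (binpoly s J).[x ^+ 2].
Proof.
rewrite /rhop /binpoly !horner_sum; apply: eq_bigr => j _.
by rewrite !hornerZ !hornerXn -exprM mul2n.
Qed.

Lemma coef_rhop_ge0 J k : 0 <= (rhop J)`_k.
Proof.
rewrite /rhop coef_sum; apply: sumr_ge0 => j _.
by rewrite coefZ coefXn mulr_ge0 ?bincoef_ge0.
Qed.

Lemma horner_rhop_ge0 J x : 0 <= (rhop J).[x].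
Proof.
rewrite horner_rhop horner_sum; apply: sumr_ge0 => j _.
by rewrite hornerZ hornerXn mulr_ge0 ?bincoef_ge0// exprn_ge0// sqr_ge0.
Qed.

Lemma horner_rhop_nondecreasing x : nondecreasing_seq (fun J => (rhop J).[x]).
Proof.
apply/nondecreasing_seqP => J; rewrite rhopS hornerD lerDl hornerZ hornerXn.
by rewrite mulr_ge0 ?bincoef_ge0// -mul2n exprM exprn_ge0// sqr_ge0.
Qed.

Lemma sqr_I11 x : I11 x -> 0 <= x ^+ 2 /\ x ^+ 2 < 1.
Proof. by move=> /in_I11 h; split; [exact: sqr_ge0|lra]. Qed.

Lemma horner_rhop_le J x : I11 x -> (rhop J).[x] <= (1 - x ^+ 2) `^ (- s).
Proof.
move=> Ix; have [y0 y1] := sqr_I11 Ix.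
have /andP[h _] := binpoly_defect s_gt0 s_le1 J y0 y1.
have w := powR_gt0 s (in_I11 Ix).
by rewrite -(ler_pM2r w) horner_rhop powRN mulVf ?gt_eqF// -subr_ge0.
Qed.

Lemma horner_rhop_cvg x : I11 x -> (rhop J).[x] @[J --> \oo] --> (1 - x ^+ 2) `^ (- s).
Proof.
move=> Ix; have [y0 y1] := sqr_I11 Ix; have w0 := in_I11 Ix.
set y := x ^+ 2 in y0 y1 w0 *.
have h1 : (J.+1%:R * y ^+ J * (1 - y) `^ (s - 1)) @[J --> \oo] --> 0 * (1 - y) `^ (s - 1).
  by apply: cvgM; [exact: cvg_nat_geometric|exact: cvg_cst].
rewrite mul0r in h1.
have h2 : (1 - (binpoly s J).[y] * (1 - y) `^ s) @[J --> \oo] --> 0.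
  apply: squeeze_cvgr (cvg_cst 0) h1; apply: nearW => J; exact: binpoly_defect.
have h3 : ((1 - (1 - (binpoly s J).[y] * (1 - y) `^ s)) * (1 - y) `^ (- s))
    @[J --> \oo] --> (1 - 0) * (1 - y) `^ (- s).
  by apply: cvgM; [apply: cvgB => //; exact: cvg_cst|exact: cvg_cst].
rewrite subr0 mul1r in h3; apply: cvg_trans h3; apply: near_eq_cvg.
apply: nearW => J; rewrite /= horner_rhop subKr powRN mulfK// gt_eqF// powR_gt0//.
Qed.
End rho_polynomials.

(** * The truncated Hardy weight acting on the ground state *)

Section ground_state_rho.
Context {R : realType}.
Variables lam sigma : R.
Hypotheses (lam_gt0 : 0 < lam) (sigma_gt0 : 0 < sigma) (sigma_lt1 : sigma < 1).
Local Notation mu := (@lebesgue_measure R).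
Local Notation I11 := (`](-1)%R, 1%R[%classic : set R).
Local Notation G := (gegenp lam).
Local Notation lground := (lground lam sigma).
Local Notation lrho := (lrho lam sigma).
Local Notation rho := (rhop (sigma / 2)).

Lemma Lw_ground_rho_sum J n N : (n + size (rho J) <= N)%N ->
  Lw lground ((1 + 'X) * (rho J * G n)) = \sum_(m < N) gmulp lam (rho J) n m * Uw lam lground m.
Proof.
move=> hN; have h1 := lground_gt lam_gt0 sigma_gt0.
rewrite (gmulp_sum lam_gt0 hN) mulr_sumr.
under eq_bigr do rewrite -scalerAr.
rewrite (@Lw_sum _ _ _ (fun m => gmulp lam (rho J) n m *: ((1 + 'X) * G m)))//.
by apply: eq_bigr => m _; rewrite LwZ.
Qed.

(** C_n changes sign, so this does not follow by comparing integrands. Each increment in J is a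
    nonnegative multiple of x^(2j) C_n, whose expansion has nonnegative coefficients [gmul],
    integrated against w with [Uw] positive; hence the left side is nondecreasing in J. Dominated
    convergence identifies its limit with the right side. *)
Lemma Lw_ground_rho_le J n : Lw lground ((1 + 'X) * (rho J * G n)) <= Uw lam lrho n.
Proof.
have h1 := lground_gt lam_gt0 sigma_gt0; have h2 := lrho_gt lam_gt0 sigma_lt1.
have s0 : 0 < sigma / 2 by rewrite divr_gt0.
have s1 : sigma / 2 <= 1 by have := sigma_lt1; lra.
pose a J := Lw lground ((1 + 'X) * (rho J * G n)).
have nd : nondecreasing_seq a.
  apply/nondecreasing_seqP => {}J; rewrite /a rhopS [(rho J + _) * G n]mulrDl
    [X in _ <= Lw _ X]mulrDr LwD// lerDl.
  rewrite -scalerAl -scalerAr LwZ// mulr_ge0 ?bincoef_ge0//.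
  rewrite (gmul_sum lam_gt0 (ltnSn _)) mulr_sumr.
  under eq_bigr do rewrite -scalerAr.
  rewrite (@Lw_sum _ _ _ (fun m => gmul lam _ n m *: ((1 + 'X) * G m)))//.
  apply: sumr_ge0 => m _; rewrite LwZ// mulr_ge0 ?gmul_ge0//.
  by apply/ltW/Uw_gt0 => //; exact: lground_lt.
have wE x : I11 x -> weight lrho x = (1 - x ^+ 2) `^ (- (sigma / 2)) * weight lground x.
  move=> Ix; rewrite /weight -gt0_powRD ?in_I11//; congr powR.
  by rewrite /lrho /lground; field.
have cv : a J @[J --> \oo] --> Uw lam lrho n.
  have [||||||_ h] := @dominated_cvg_EFin _ _ _ mu I11
     (fun J x => ((1 + 'X) * (rho J * G n)).[x] * weight lground x)
     (fun x => ((1 + 'X) * G n).[x] * weight lrho x)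
     (fun x => poly_bound ((1 + 'X) * G n) * weight lrho x).
  - by [].
  - move=> k; apply: measurable_funM; first exact: measurable_horner.
    by apply/measurable_funTS; exact: measurable_weight.
  - apply: measurable_funM; first exact: measurable_horner.
    by apply/measurable_funTS; exact: measurable_weight.
  - move=> x Ix; rewrite wE// mulrA; apply: cvgM; last exact: cvg_cst.
    have -> : (fun k => ((1 + 'X) * (rho k * G n)).[x]) =
        (fun k => ((1 + 'X) * G n).[x] * (rho k).[x]).
      by apply/funext => k; rewrite !hornerM; ring.
    by apply: cvgM; [exact: cvg_cst|exact: horner_rhop_cvg].
  - by apply: integrableZl_fun => //; exact: integrable_weight.
  - move=> k x Ix; have -> : (1 + 'X) * (rho k * G n) = (1 + 'X) * G n * rho k by ring.
    rewrite normrM (ger0_norm (weight_ge0 _ _)) wE// mulrA ler_wpM2r ?weight_ge0//.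
    rewrite hornerM normrM ler_pM ?horner_bound_I11//.
    by rewrite ger0_norm ?horner_rhop_ge0// horner_rhop_le.
  move: h; rewrite -/(muint lrho (horner _)) -/(Lw _ _) LwE//.
  by move=> /fine_cvgP[].
by rewrite -(cvg_lim _ cv)//; apply: nondecreasing_cvgn_le => //; apply/cvg_ex; exists (Uw lam lrho n).
Qed.
End ground_state_rho.

(** * Density of polynomials *)

Section polynomial_density.
Context {R : realType}.
Variable l : R.
Hypothesis l_gt : - 2^-1 < l.
Local Notation mu := (@lebesgue_measure R).
Local Notation I11 := (`](-1)%R, 1%R[%classic : set R).
Implicit Types (f g h : R -> R) (p q : {poly R}).

Definition L2sq f : \bar R := muint l (fun x => f x ^+ 2).

Lemma measurable_sqr_weight f : measurable_fun I11 f ->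
  measurable_fun I11 (EFin \o (fun x => f x ^+ 2 * weight l x)).
Proof.
move=> mf; apply/measurable_EFinP; apply: measurable_funM; first exact: measurable_funX.
by apply/measurable_funTS; exact: measurable_weight.
Qed.

Lemma sqr_weight_ge0 f x : 0 <= f x ^+ 2 * weight l x.
Proof. by rewrite mulr_ge0 ?sqr_ge0 ?weight_ge0. Qed.

Lemma L2sq_le f g : measurable_fun I11 f -> measurable_fun I11 g ->
  (forall x, I11 x -> `|f x| <= `|g x|) -> (L2sq f <= L2sq g)%E.
Proof.
move=> mf mg fg; apply: ge0_le_integral => //.
- by move=> x _; rewrite lee_fin mulr_ge0 ?sqr_ge0 ?weight_ge0.
- exact: measurable_sqr_weight.
- exact: measurable_sqr_weight.
- move=> x Ix; rewrite lee_fin ler_wpM2r ?weight_ge0//.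
  by rewrite -[leLHS]real_normK ?num_real// -[leRHS]real_normK ?num_real// lerXn2r ?nnegrE// fg.
Qed.

Lemma L2sqZ c f : measurable_fun I11 f ->
  L2sq (fun x => c * f x) = ((c ^+ 2)%:E * L2sq f)%E.
Proof.
move=> mf; rewrite /L2sq /muint -ge0_integralZl//.
- by apply: eq_integral => x _; rewrite -EFinM; congr EFin; ring.
- exact: measurable_sqr_weight.
- by move=> x _; rewrite lee_fin mulr_ge0 ?sqr_ge0 ?weight_ge0.
- by rewrite lee_fin sqr_ge0.
Qed.

(** From (a + b)^2 <= 2 a^2 + 2 b^2. It stands in for the triangle inequality without square roots,
    which is why errors are split as e / 4 below. *)
Lemma L2sqD f g : measurable_fun I11 f -> measurable_fun I11 g ->
  (L2sq (fun x => f x + g x)%R <= 2%:E * L2sq f + 2%:E * L2sq g)%E.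
Proof.
move=> mf mg.
pose F x := f x ^+ 2 * weight l x; pose H x := g x ^+ 2 * weight l x.
have mF : measurable_fun I11 F by apply/measurable_EFinP; exact: measurable_sqr_weight.
have mH : measurable_fun I11 H by apply/measurable_EFinP; exact: measurable_sqr_weight.
have F0 x : 0 <= F x by exact: sqr_weight_ge0.
have H0 x : 0 <= H x by exact: sqr_weight_ge0.
have -> : (2%:E * L2sq f + 2%:E * L2sq g =
    \int[mu]_(x in I11) ((2 * F x)%:E + (2 * H x)%:E))%E.
  rewrite ge0_integralD//.
  - congr (_ + _)%E; under eq_integral do rewrite EFinM; rewrite ge0_integralZl//.
    + exact/measurable_EFinP.
    + by move=> x _; rewrite lee_fin.
    + exact/measurable_EFinP.
    + by move=> x _; rewrite lee_fin.
  - by move=> x _; rewrite lee_fin mulr_ge0.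
  - by apply/measurable_EFinP; exact: measurable_funM.
  - by move=> x _; rewrite lee_fin mulr_ge0.
  - by apply/measurable_EFinP; exact: measurable_funM.
apply: ge0_le_integral => //.
- by move=> x _; rewrite lee_fin mulr_ge0 ?sqr_ge0 ?weight_ge0.
- exact: (measurable_sqr_weight (measurable_funD mf mg)).
- by apply: emeasurable_funD; apply/measurable_EFinP; exact: measurable_funM.
- move=> x _; rewrite -EFinD lee_fin /F /H !mulrA -mulrDl ler_wpM2r ?weight_ge0//.
  by have := sqr_ge0 (f x - g x); nra.
Qed.

Definition L2approx f := measurable_fun I11 f /\
  forall e, 0 < e -> exists p, (L2sq (fun x => f x - p.[x])%R <= e%:E)%E.

Lemma L2sq_eq f g : (forall x, I11 x -> f x = g x) -> L2sq f = L2sq g.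
Proof. by move=> fg; apply: eq_integral => x /set_mem Ix; rewrite fg. Qed.

Lemma L2approx_close f : measurable_fun I11 f ->
  (forall e, 0 < e -> exists2 g, L2approx g & (L2sq (fun x => f x - g x)%R <= e%:E)%E) ->
  L2approx f.
Proof.
move=> mf h; split => // e e0; have e4 : 0 < e / 4 by rewrite divr_gt0.
have [g [mg ag] fg] := h _ e4; have [p gp] := ag _ e4; exists p.
have -> : L2sq (fun x => f x - p.[x]) = L2sq (fun x => (f x - g x) + (g x - p.[x])).
  by apply: L2sq_eq => x _; ring.
apply: (le_trans (L2sqD _ _)).
- exact: measurable_funB.
- by apply: measurable_funB => //; exact: measurable_horner.
have -> : e%:E = (2%:E * (e / 4)%:E + 2%:E * (e / 4)%:E)%E.
  by rewrite -!EFinM -EFinD; congr EFin; field.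
by apply: leeD; rewrite lee_pmul2l// lte_fin.
Qed.

Lemma L2approxD f g : L2approx f -> L2approx g -> L2approx (fun x => f x + g x).
Proof.
move=> [mf af] [mg ag]; split; first exact: measurable_funD.
move=> e e0; have e4 : 0 < e / 4 by rewrite divr_gt0.
have [p fp] := af _ e4; have [q gq] := ag _ e4; exists (p + q).
have -> : L2sq (fun x => f x + g x - (p + q).[x]) =
    L2sq (fun x => (f x - p.[x]) + (g x - q.[x])).
  by apply: L2sq_eq => x _; rewrite hornerD; ring.
apply: (le_trans (L2sqD _ _)); try by apply: measurable_funB => //; exact: measurable_horner.
have -> : e%:E = (2%:E * (e / 4)%:E + 2%:E * (e / 4)%:E)%E.
  by rewrite -!EFinM -EFinD; congr EFin; field.
by apply: leeD; rewrite lee_pmul2l// lte_fin.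
Qed.

Lemma L2approxZ c f : L2approx f -> L2approx (fun x => c * f x).
Proof.
move=> [mf af]; split; first exact: measurable_funM.
(* The summand 1 keeps the divisor positive when c = 0. *)
have c1 : 0 < c ^+ 2 + 1 by rewrite ltr_wpDl// sqr_ge0.
move=> e e0; have [p fp] := af _ (divr_gt0 e0 c1); exists (c *: p).
have -> : L2sq (fun x => c * f x - (c *: p).[x]) = L2sq (fun x => c * (f x - p.[x])).
  by apply: L2sq_eq => x _; rewrite hornerZ; ring.
rewrite L2sqZ; last by apply: measurable_funB => //; exact: measurable_horner.
apply: (@le_trans _ _ ((c ^+ 2)%:E * (e / (c ^+ 2 + 1))%:E)%E).
  by rewrite lee_wpmul2l// lee_fin sqr_ge0.
rewrite -EFinM lee_fin mulrA ler_pdivrMr//; nra.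
Qed.

Lemma L2approx_poly p : L2approx (horner p).
Proof.
split; first exact: measurable_horner.
move=> e e0; exists p; rewrite (@L2sq_eq _ (fun=> 0)); last by move=> x _; rewrite subrr.
rewrite /L2sq /muint; under eq_integral do rewrite expr0n mul0r.
by rewrite integral0 lee_fin ltW.
Qed.

Lemma L2approx_cvg (f_ : (R -> R)^nat) f h : (forall n, L2approx (f_ n)) ->
  measurable_fun I11 f ->
  (forall x, I11 x -> f_ n x @[n --> \oo] --> f x) ->
  (forall n x, I11 x -> `|f x - f_ n x| <= `|h x|) ->
  mu.-integrable I11 (EFin \o (fun x => h x ^+ 2 * weight l x)) -> L2approx f.
Proof.
move=> af mf ff fh ih; apply: L2approx_close => // e e0.
have [||||||_ c] := @dominated_cvg_EFin _ _ _ mu I11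
  (fun n x => (f x - f_ n x) ^+ 2 * weight l x) (fun=> 0) (fun x => h x ^+ 2 * weight l x).
- by [].
- move=> n; apply/measurable_EFinP; apply: measurable_sqr_weight.
  by apply: measurable_funB => //; case: (af n).
- exact: measurable_cst.
- move=> x Ix; rewrite [X in _ --> X](_ : 0 = (f x - f x) ^+ 2 * weight l x); last first.
    by rewrite subrr expr0n mul0r.
  apply: cvgM; last exact: cvg_cst.
  rewrite expr2; under eq_fun do rewrite expr2.
  by apply: cvgM; apply: cvgB; try exact: cvg_cst; exact: ff.
- exact: ih.
- move=> n x Ix; rewrite ger0_norm; last by apply: mulr_ge0; [exact: sqr_ge0|exact: weight_ge0].
  rewrite ler_wpM2r ?weight_ge0//.
  by rewrite -[leLHS]real_normK ?num_real// -[leRHS]real_normK ?num_real// lerXn2r ?nnegrE// fh.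
rewrite integral0 in c; have /fine_cvgP[fin /cvgrPdist_le/(_ e e0)] := c.
(* Past N the real part of the integral is below e; past M the integral is finite, which must be
   required too since [fine] sends an infinite value to 0. *)
move=> [N _ hN]; have [M _ hM] := fin.
exists (f_ (maxn N M)) => //.
have h1 := hN (maxn N M) (leq_maxl _ _); have h2 := hM (maxn N M) (leq_maxr _ _).
rewrite /L2sq /muint -[leLHS]fineK// lee_fin.
by apply: le_trans h1; rewrite /= sub0r normrN ler_norm.
Qed.
End polynomial_density.

(** * From rays to measurable sets, simple functions and all of L^2 *)

Section polynomial_density_L2.
Import HBNNSimple.
Context {R : realType}.
Variable l : R.
Hypothesis l_gt : - 2^-1 < l.
Local Notation mu := (@lebesgue_measure R).
Local Notation I11 := (`](-1)%R, 1%R[%classic : set R).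
Implicit Types (f g h : R -> R) (q : R).

Lemma bernoulli_ge (z : R) k : 0 <= z <= 1 -> 1 - k%:R * z <= (1 - z) ^+ k.
Proof.
move=> /andP[z0 z1]; elim: k => [|k IH]; first by rewrite mul0r subr0 expr0.
rewrite exprS; apply: (@le_trans _ _ ((1 - z) * (1 - k%:R * z))).
  have : 0 <= k%:R * z ^+ 2 :> R by rewrite mulr_ge0// sqr_ge0.
  by rewrite -natr1 expr2; nra.
by rewrite ler_wpM2l// subr_ge0.
Qed.

Lemma bernoulli_le (z : R) k : 0 <= z <= 1 -> (1 - z) ^+ k * (1 + k%:R * z) <= 1.
Proof.
move=> /andP[z0 z1].
have h : 1 + k%:R * z <= (1 + z) ^+ k.
  elim: k => [|k IH]; first by rewrite mul0r addr0 expr0.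
  rewrite exprS; apply: (@le_trans _ _ ((1 + z) * (1 + k%:R * z))).
    have : 0 <= k%:R * z ^+ 2 :> R by rewrite mulr_ge0// sqr_ge0.
    by rewrite -natr1 expr2; nra.
  by rewrite ler_wpM2l// addr_ge0.
apply: (@le_trans _ _ ((1 - z) ^+ k * (1 + z) ^+ k)).
  by rewrite ler_wpM2l// exprn_ge0// subr_ge0.
by rewrite -exprMn exprn_ile1//; nra.
Qed.

(* The factor n.+1 makes the limit 0 also at q = 1/2, so that no null set has to be discarded. *)
Definition stepseq (q : R) n := (1 - q ^+ n) ^+ (n.+1 * 2 ^ n).

Lemma stepseq_itv q n : 0 <= q <= 1 -> 0 <= stepseq q n <= 1.
Proof.
move=> /andP[q0 q1]; have h : 0 <= q ^+ n <= 1 by rewrite exprn_ge0// exprn_ile1.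
by rewrite exprn_ge0 ?exprn_ile1//; lra.
Qed.

(** Source of the threshold 1/2: the quantity in both Bernoulli estimates, exponent times q^n, is (n
    + 1) (2 q)^n. It tends to 0 below 1/2 and is at least n + 1 from 1/2 on. *)
Lemma stepseq_kz q n : (n.+1 * 2 ^ n)%:R * q ^+ n = n.+1%:R * (2 * q) ^+ n :> R.
Proof. by rewrite natrM natrX exprMn mulrA. Qed.

Lemma stepseq_cvg1 q : 0 <= q -> q < 2^-1 -> stepseq q n @[n --> \oo] --> (1 : R).
Proof.
move=> q0 q1; have h : (1 - n.+1%:R * (2 * q) ^+ n) @[n --> \oo] --> (1 - 0 : R).
  apply: cvgB; first exact: cvg_cst.
  by apply: cvg_nat_geometric; lra.
rewrite subr0 in h; apply: (squeeze_cvgr _ h (cvg_cst (1 : R))).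
apply: nearW => n; have q2 : 0 <= q <= 1 by lra.
have /andP[_ ->] := stepseq_itv n q2; rewrite andbT -stepseq_kz.
by apply: bernoulli_ge; rewrite exprn_ge0// exprn_ile1//; lra.
Qed.

Lemma stepseq_cvg0 q : 2^-1 <= q -> q <= 1 -> stepseq q n @[n --> \oo] --> (0 : R).
Proof.
move=> q0 q1; have h : (n.+1%:R^-1 : R) @[n --> \oo] --> (0 : R) by exact: cvg_harmonic.
apply: squeeze_cvgr (cvg_cst 0) h.
apply: nearW => n; have q2 : 0 <= q <= 1 by lra.
have /andP[s0 _] := stepseq_itv n q2; rewrite s0/= -[leRHS]mul1r ler_pdivlMr ?ltr0n//.
have z01 : 0 <= q ^+ n <= 1 by rewrite exprn_ge0 ?exprn_ile1//; lra.
apply: le_trans (bernoulli_le (n.+1 * 2 ^ n) z01).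
rewrite -/(stepseq q n) ler_wpM2l// stepseq_kz.
have : 1 <= (2 * q) ^+ n by rewrite exprn_ege1//; lra.
have : 0 <= n.+1%:R :> R by [].
by move: (_ ^+ n) (n.+1%:R : R) => a b; nra.
Qed.

Lemma integrable_weight1 : mu.-integrable I11 (EFin \o (fun x => (1 : R) ^+ 2 * weight l x)).
Proof.
apply: eq_integrable (integrable_weight l_gt) => // x _.
by rewrite /= expr1n mul1r.
Qed.

Lemma L2approx_ray (a : R) : L2approx l (\1_(`]a, +oo[%classic)).
Proof.
have mi : measurable_fun I11 (\1_(`]a, +oo[%classic) : R -> R).
  by apply: measurable_funTS; exact: measurable_indic.
(* Clamping a to [-1, 1] leaves the ray unchanged inside (-1, 1) and bounds |x - b| by 2. *)
pose b : R := Num.max (-1) (Num.min 1 a).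
have b1 : -1 <= b <= 1.
  by rewrite /b le_max lexx ge_max ge_min lexx andbT/=; lra.
have iE x : I11 x -> \1_(`]a, +oo[%classic) x = (b < x)%R%:R :> R.
  rewrite /= in_itv/= => /andP[x1 x2]; rewrite indicE; congr ((nat_of_bool _)%:R).
  rewrite /b gt_max x1 gt_min ltNge (ltW x2)/=.
  by apply/idP/idP; rewrite inE/= in_itv/= andbT.
(* The affine function 1/2 - (x - b)/4 stays in [0, 1] on the interval and is below 1/2 exactly to
   the right of b. *)
pose q : {poly R} := (2^-1 + b / 4)%:P - 4^-1 *: 'X.
have qE x : q.[x] = 2^-1 - (x - b) / 4.
  by rewrite /q !(hornerD, hornerN, hornerZ, hornerC, hornerX); field.
pose P n := (1 - q ^+ n) ^+ (n.+1 * 2 ^ n).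
have PE n x : (P n).[x] = stepseq q.[x] n.
  by rewrite /P horner_exp hornerD hornerN horner_exp hornerC.
have q01 x : I11 x -> 0 <= q.[x] <= 1.
  by rewrite /= in_itv/= qE => /andP[x1 x2]; lra.
apply: (@L2approx_cvg _ l (fun n => horner (P n)) _ (fun=> 1)).
- by move=> n; exact: L2approx_poly.
- exact: mi.
- move=> x Ix; under eq_fun do rewrite PE; rewrite iE//.
  have /andP[q0 q1] := q01 _ Ix; have qx := qE x; case: ltP => bx.
    by apply: stepseq_cvg1 => //; lra.
  by apply: stepseq_cvg0 => //; lra.
- move=> n x Ix; rewrite iE// normr1 PE.
  have /andP[s0 s1] := stepseq_itv n (q01 _ Ix).
  by case: (b < x); rewrite /= ?mulr0n ?mulr1n ler_norml; lra.
- exact: integrable_weight1.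
Qed.

Lemma L2approx_eq f g : (forall x, f x = g x) -> L2approx l f -> L2approx l g.
Proof. by move=> /funext ->. Qed.

Lemma L2approx_sum n (F : nat -> R -> R) : (forall i, L2approx l (F i)) ->
  L2approx l (fun x => \sum_(i < n) F i x).
Proof.
move=> hF; elim: n => [|n IH].
  by apply: (@L2approx_eq (horner 0)); [move=> x; rewrite big_ord0 horner0|exact: L2approx_poly].
apply: (@L2approx_eq (fun x => \sum_(i < n) F i x + F n x)).
  by move=> x; rewrite big_ord_recr.
exact: L2approxD.
Qed.

(** Complements come from 1 - 1_A; disjoint unions come from dominated convergence of finite sums of
    indicators, with the constant 1 as dominating function since the measure is finite. *)
Lemma L2approx_dynkin : dynkin [set A : set R | measurable A /\ L2approx l (\1_A)].
Proof.
split.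
- split; first exact: measurableT.
  by apply: (@L2approx_eq (horner 1)); [move=> x; rewrite hornerC indicT|exact: L2approx_poly].
- move=> A [mA aA]; split; first exact: measurableC.
  apply: (@L2approx_eq (fun x => (1 : {poly R}).[x] + (-1) * \1_A x)).
    move=> x; rewrite hornerC !indicE in_setC; case: (x \in A) => /=; ring.
  by apply: L2approxD; [exact: L2approx_poly|exact: L2approxZ].
- move=> F tF hF.
  have mF : measurable (\bigcup_k F k) by apply: bigcup_measurable => k _; case: (hF k).
  split => //.
  have sE n x : \sum_(i < n) (\1_(F i) x : R) = \1_(\big[setU/set0]_(i < n) F i) x.
    rewrite -bigcup_mkord indicE; case: (pselect ((\bigcup_(k in `I_n) F k) x)).
      move=> h; have [i /= ni Fix] := h; rewrite (mem_set h) (bigD1 (Ordinal ni))//=.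
      rewrite indicE mem_set// big1 ?addr0// => j ji; rewrite indicE memNset// => Fjx.
      move/eqP: ji; apply; apply/val_inj => /=.
      by have /trivIsetP/(_ j i Logic.I Logic.I) := tF; case: eqVneq => // _ /(_ isT) /seteqP[/(_ x)]; case.
    move=> h; rewrite (memNset h) big1// => j _; rewrite indicE memNset// => Fjx.
    by apply: h; exists j => /=.
  apply: (@L2approx_cvg _ l (fun n x => \sum_(i < n) (\1_(F i) x)) _ (fun=> 1)).
  + by move=> n; apply: (@L2approx_sum n (fun i => \1_(F i))) => i; case: (hF i).
  + by apply: measurable_funTS; exact: measurable_indic.
  + move=> x Ix; apply: cvg_near_cst.
    have [[k _ Fkx]|nF] := pselect ((\bigcup_k F k) x); last first.
      apply: nearW => n.
      have nFn : ~ (\big[setU/set0]_(i < n) F i) x.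
        by rewrite -bigcup_mkord => -[i _ Fix]; apply: nF; exists i.
      by rewrite sE !indicE (memNset nF) (memNset nFn).
    near=> n.
    have Fn : (\big[setU/set0]_(i < n) F i) x.
      by rewrite -bigcup_mkord; exists k => //=; near: n; exact: nbhs_infty_gt.
    by rewrite sE !indicE (mem_set Fn) mem_set//; exists k.
  + move=> n x Ix; rewrite sE normr1 !indicE.
    by do 2 case: (_ \in _) => /=; rewrite ?subrr ?subr0 ?sub0r ?normrN ?normr1 ?normr0.
  + exact: integrable_weight1.
Unshelve. all: end_near. Qed.

(** Dynkin's pi-lambda theorem: the open rays are closed under intersection and generate the Borel
    sets, so the Dynkin class containing them contains every measurable set. *)
Lemma L2approx_indic (A : set R) : measurable A -> L2approx l (\1_A).
Proof.
move=> mA.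
have GI : setI_closed (@RGenOInfty.G R).
  move=> _ _ [x ->] [y ->]; exists (Num.max x y).
  apply/seteqP; split => z /=; rewrite !in_itv/= !andbT gt_max; first by move=> [-> ->].
  by move=> /andP[].
have sA : (@RGenOInfty.G R).-sigma.-measurable A by rewrite -RGenOInfty.measurableE.
have : (<<s @RGenOInfty.G R >>) A by exact: sA.
rewrite -(setI_closed_g_dynkin_g_sigma_algebra GI).
move=> /(_ [set A : set R | measurable A /\ L2approx l (\1_A)]) [].
  split; first exact: L2approx_dynkin.
  by move=> _ [x ->]; split => //; exact: L2approx_ray.
by [].
Qed.

Lemma L2approx_nnsfun (f : {nnsfun R >-> R}) : L2approx l (fun x => f x).
Proof.
have -> : (fun x => f x) = (fun x =>
    \sum_(y <- finmap.enum_fset (fset_set (range f))) (y * \1_(f @^-1` [set y]) x)).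
  by apply/funext => x; rewrite fimfunE fsbig_finite.
elim: (finmap.enum_fset _) => [|y s IH].
  by apply: (@L2approx_eq (horner 0)); [move=> x; rewrite big_nil horner0|exact: L2approx_poly].
apply: (@L2approx_eq (fun x => y * \1_(f @^-1` [set y]) x +
    \sum_(y <- s) y * \1_(f @^-1` [set y]) x)).
  by move=> x; rewrite big_cons.
by apply: L2approxD => //; apply: L2approxZ; exact: L2approx_indic.
Qed.

Lemma L2approx_ge0 f : measurable_fun I11 f -> (forall x, I11 x -> 0 <= f x) ->
  mu.-integrable I11 (EFin \o (fun x => f x ^+ 2 * weight l x)) -> L2approx l f.
Proof.
move=> mf f0 i2.
have mfE : measurable_fun I11 (EFin \o f) by exact/measurable_EFinP.
have mI : measurable I11 by [].
pose g := nnsfun_approx mI mfE.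
have cg x : I11 x -> g n x @[n --> \oo] --> f x.
  move=> Ix; have := @cvg_nnsfun_approx _ _ _ _ mI _ mfE (fun x Ix => f0 x Ix) x Ix.
  by move=> /fine_cvgP[].
have gf n x : I11 x -> g n x <= f x.
  move=> Ix; rewrite -(cvg_lim _ (cg x Ix))//.
  apply: (nondecreasing_cvgn_le (u_ := fun n => g n x)).
    by move=> i j ij; have /lefP := nd_nnsfun_approx mI mfE ij; exact.
  by apply/cvg_ex; exists (f x); exact: cg.
apply: (@L2approx_cvg _ l g _ f) => //.
- by move=> n; exact: L2approx_nnsfun.
- move=> n x Ix; rewrite !ger0_norm ?f0 ?subr_ge0 ?gf//.
  by rewrite lerBlDr lerDl.
Qed.

Lemma polynomials_dense f : measurable_fun I11 f -> (L2sq l f < +oo)%E -> L2approx l f.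
Proof.
move=> mf fy.
have i2 g : measurable_fun I11 g -> (forall x, I11 x -> `|g x| <= `|f x|) ->
    mu.-integrable I11 (EFin \o (fun x => g x ^+ 2 * weight l x)).
  move=> mg gf; apply/integrableP; split; first exact: measurable_sqr_weight.
  apply: le_lt_trans fy; apply: le_trans (L2sq_le _ mg mf gf).
  rewrite le_eqVlt; apply/orP; left; apply/eqP; apply: eq_integral => x _.
  by rewrite /= ger0_norm// sqr_weight_ge0.
have mx (x : R) : 0 <= Num.max x 0 by rewrite le_max lexx orbT.
have mxn (x : R) : `|Num.max x 0| <= `|x|.
  by rewrite ger0_norm// ge_max normr_ge0 ler_norm.
have mmx g : measurable_fun I11 g -> measurable_fun I11 (fun x => Num.max (g x) 0).
  by move=> mg; exact: measurable_maxr.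
apply: (@L2approx_eq (fun x => Num.max (f x) 0 + (-1) * Num.max (- f x) 0)).
  move=> x; case: (lerP (f x) 0) => h.
    by rewrite max_l ?oppr_ge0//; ring.
  by rewrite max_r ?oppr_le0 ?(ltW h)//; ring.
apply: L2approxD; [|apply: L2approxZ]; apply: L2approx_ge0 => //.
- exact: mmx.
- by apply: i2 => //; exact: mmx.
- by apply: mmx; exact: measurable_funN.
- apply: i2; first by apply: mmx; exact: measurable_funN.
  by move=> x Ix; rewrite (le_trans (mxn _))// normrN.
Qed.

End polynomial_density_L2.

(** * Hardy inequality *)

(** Each product e_n e_m is at most the mean of e_n^2 w_m / w_n and e_m^2 w_n / w_m, the defect
    being a square over w_n w_m. By symmetry of [K] both halves have the same sum, which the row
    bound controls. *)
Lemma schur_test (R : realFieldType) N (K : nat -> nat -> R) (w c e : nat -> R) :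
  (forall n m, 0 <= K n m) -> (forall n m, K n m = K m n) -> (forall n, 0 < w n) ->
  (forall n, \sum_(m < N) K n m * w m <= c n * w n) ->
  \sum_(n < N) \sum_(m < N) e n * e m * K n m <= \sum_(n < N) c n * e n ^+ 2.
Proof.
move=> K0 KC w0 Kw.
pose T := \sum_(n < N) \sum_(m < N) K n m * (e n ^+ 2 * (w m / w n)).
have T1 : T <= \sum_(n < N) c n * e n ^+ 2.
  apply: ler_sum => n _.
  have -> : \sum_(m < N) K n m * (e n ^+ 2 * (w m / w n)) =
      e n ^+ 2 / w n * \sum_(m < N) K n m * w m.
    by rewrite mulr_sumr; apply: eq_bigr => m _; ring.
  have -> : c n * e n ^+ 2 = e n ^+ 2 / w n * (c n * w n).
    by field; rewrite gt_eqF.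
  by rewrite ler_wpM2l// divr_ge0 ?sqr_ge0 ?ltW.
apply: le_trans T1.
have T2 : T = \sum_(n < N) \sum_(m < N) K n m * (e m ^+ 2 * (w n / w m)).
  by rewrite /T exchange_big/=; apply: eq_bigr => n _; apply: eq_bigr => m _; rewrite KC.
have -> : T = \sum_(n < N) \sum_(m < N)
    2^-1 * (K n m * (e n ^+ 2 * (w m / w n)) + K n m * (e m ^+ 2 * (w n / w m))).
  have {1}-> : T = 2^-1 * (T + T) by field.
  rewrite {2}T2 /T -big_split/= mulr_sumr; apply: eq_bigr => n _.
  by rewrite -big_split/= mulr_sumr.
apply: ler_sum => n _; apply: ler_sum => m _.
have [wn wm] := (w0 n, w0 m).
have -> : 2^-1 * (K n m * (e n ^+ 2 * (w m / w n)) + K n m * (e m ^+ 2 * (w n / w m))) =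
    e n * e m * K n m + 2^-1 * (K n m * ((e n * w m - e m * w n) ^+ 2 / (w n * w m))).
  by field; rewrite !gt_eqF.
rewrite lerDl; apply: mulr_ge0; first by rewrite invr_ge0.
by apply: mulr_ge0 => //; apply: divr_ge0; [exact: sqr_ge0|rewrite ltW// mulr_gt0].
Qed.

Section hardy.
Context {R : realType}.
Variables lam sigma : R.
Hypotheses (lam_gt0 : 0 < lam) (sigma_gt0 : 0 < sigma) (sigma_lt1 : sigma < 1).
Local Notation mu := (@lebesgue_measure R).
Local Notation I11 := (`](-1)%R, 1%R[%classic : set R).
Local Notation G := (gegenp lam).
Local Notation rho := (rhop (sigma / 2)).
Local Notation h := (gnorm2 lam).
Local Notation Q := (Qconst sigma lam).
Local Notation m := (Amult sigma lam).
Implicit Types (p q : {poly R}).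

Lemma hardy_finite_sum J N (e : nat -> R) :
  Q * Lw lam (rho J * (\sum_(n < N) e n *: G n) ^+ 2) <=
  \sum_(n < N) m n * (e n ^+ 2 * h n).
Proof.
have hl := half_lt_lam lam_gt0.
have Q0 := Qconst_gt0 lam_gt0 sigma_gt0 sigma_lt1.
have hl1 := lground_gt lam_gt0 sigma_gt0.
pose K n k := Lw lam (rho J * G n * G k).
have KE n k : K n k = gmulp lam (rho J) n k * h k by exact: Lw_mul_gegenp2.
have hn n := gnorm2_gt0 lam_gt0 n.
have U0 n : 0 < Uw lam (lground lam sigma) n by apply: Uw_gt0 => //; exact: lground_lt.
have s0 : 0 < sigma / 2 by rewrite divr_gt0.
have g0 n k : 0 <= gmulp lam (rho J) n k.
  by apply: gmulp_ge0 => // i; exact: coef_rhop_ge0.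
have -> : Lw lam (rho J * (\sum_(n < N) e n *: G n) ^+ 2) =
    \sum_(n < N) \sum_(k < N) e n * e k * K n k.
  have -> : rho J * (\sum_(n < N) e n *: G n) ^+ 2 =
      \sum_(n < N) \sum_(k < N) (e n * e k) *: (rho J * G n * G k).
    rewrite expr2 mulrA [rho J * _]mulr_sumr mulr_suml; apply: eq_bigr => n _.
    rewrite mulr_sumr; apply: eq_bigr => k _.
    by rewrite -!mul_polyC polyCM; ring.
  rewrite (@Lw_sum _ _ _ (fun n => \sum_(k < N) (e n * e k) *: (rho J * G n * G k)))//.
  apply: eq_bigr => n _.
  rewrite (@Lw_sum _ _ _ (fun k => (e n * e k) *: (rho J * G n * G k)))//.
  by apply: eq_bigr => k _; rewrite LwZ.
rewrite -ler_pdivlMl// mulr_sumr.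
have -> : \sum_(n < N) Q^-1 * (m n * (e n ^+ 2 * h n)) =
    \sum_(n < N) (Q^-1 * (m n * h n)) * e n ^+ 2.
  by apply: eq_bigr => n _; ring.
(* The polynomials C_n are orthogonal but not normalised, so the coefficient of w along C_n is its
   inner product [Uw] divided by [h n]; this also cancels the factor [h k] in [K n k]. *)
apply: (@schur_test _ N K (fun n => Uw lam (lground lam sigma) n / h n)
  (fun n => Q^-1 * (m n * h n)) e).
- by move=> n k; rewrite KE mulr_ge0// ltW.
- by move=> n k; rewrite /K mulrAC.
- by move=> n; rewrite divr_gt0.
move=> n.
have -> : \sum_(k < N) K n k * (Uw lam (lground lam sigma) k / h k) =
    \sum_(k < N) gmulp lam (rho J) n k * Uw lam (lground lam sigma) k.
  by apply: eq_bigr => k _; rewrite KE; field; rewrite gt_eqF.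
have -> : Q^-1 * (m n * h n) * (Uw lam (lground lam sigma) n / h n) =
    Q^-1 * (m n * Uw lam (lground lam sigma) n).
  by field; rewrite !gt_eqF.
rewrite ler_pdivlMl//.
apply: le_trans (Uw_ground_super lam_gt0 sigma_gt0 sigma_lt1 n).
rewrite ler_pM2l//; apply: le_trans (Lw_ground_rho_le lam_gt0 sigma_gt0 sigma_lt1 J n).
(* The row sum cut at N is extended until it contains the whole expansion of rho_J C_n; the added
   terms are nonnegative. *)
have hN : (n + size (rho J) <= N + (n + size (rho J)))%N by rewrite leq_addl.
rewrite (Lw_ground_rho_sum lam_gt0 sigma_gt0 hN) big_split_ord/= lerDl.
by apply: sumr_ge0 => k _; rewrite mulr_ge0// ltW.
Qed.

Variable u : R -> R.
Hypothesis mu_ : measurable_fun I11 u.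
Hypothesis u2 : (L2sq lam u < +oo)%E.

Lemma integrable_u2 : mu.-integrable I11 (EFin \o (fun x => u x ^+ 2 * weight lam x)).
Proof.
apply/integrableP; split; first exact: measurable_sqr_weight.
apply: le_lt_trans u2; rewrite le_eqVlt; apply/orP; left; apply/eqP.
by apply: eq_integral => x _; rewrite /= ger0_norm// sqr_weight_ge0.
Qed.

Lemma integrable_u2_poly p :
  mu.-integrable I11 (EFin \o (fun x => u x ^+ 2 * p.[x] * weight lam x)).
Proof.
apply: (@le_integrable_fun _ _ _ mu _ _ _ (fun x => poly_bound p * (u x ^+ 2 * weight lam x))) => //.
- apply: measurable_funM; last by apply/measurable_funTS; exact: measurable_weight.
  by apply: measurable_funM; [exact: measurable_funX|exact: measurable_horner].
- move=> x Ix; rewrite normrM [`|u x ^+ 2 * _|]normrM (ger0_norm (sqr_ge0 (u x)))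
    (ger0_norm (weight_ge0 _ _)).
  rewrite mulrA ler_wpM2r ?weight_ge0// mulrC ler_wpM2r ?sqr_ge0//.
  exact: horner_bound_I11.
- by apply: integrableZl_fun => //; exact: integrable_u2.
Qed.

Lemma integrable_u_poly p :
  mu.-integrable I11 (EFin \o (fun x => u x * p.[x] * weight lam x)).
Proof.
have hl := half_lt_lam lam_gt0.
apply: (@le_integrable_fun _ _ _ mu _ _ _
  (fun x => poly_bound p * (u x ^+ 2 * weight lam x + weight lam x))) => //.
- apply: measurable_funM; last by apply/measurable_funTS; exact: measurable_weight.
  by apply: measurable_funM => //; exact: measurable_horner.
- move=> x Ix; rewrite !normrM (ger0_norm (weight_ge0 _ _)) -[X in _ + X]mul1r -mulrDl mulrA.
  rewrite ler_wpM2r ?weight_ge0// mulrC ler_pM//; first exact: horner_bound_I11.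
  by rewrite -[X in _ <= X + _]real_normK ?num_real//; move: `|u x| (normr_ge0 (u x)) => a a0; nra.
- apply: integrableZl_fun => //; apply: integrableD_fun => //; first exact: integrable_u2.
  exact: integrable_weight.
Qed.

Definition uL p : R := \int[mu]_(x in I11) (u x * p.[x] * weight lam x).

Lemma uLD p q : uL (p + q) = uL p + uL q.
Proof.
rewrite /uL -RintegralD//; try exact: integrable_u_poly.
by apply: eq_Rintegral => x _; rewrite hornerD; ring.
Qed.

Lemma uLZ c p : uL (c *: p) = c * uL p.
Proof.
rewrite /uL -RintegralZl//; last exact: integrable_u_poly.
by apply: eq_Rintegral => x _; rewrite hornerZ; ring.
Qed.

Lemma uL_sum n (F : nat -> {poly R}) : uL (\sum_(i < n) F i) = \sum_(i < n) uL (F i).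
Proof.
elim: n => [|n IH]; last by rewrite !big_ord_recr/= uLD IH.
by rewrite !big_ord0 -(scale0r 0) uLZ mul0r.
Qed.

Lemma gegen_normE n : gegen_norm lam n = Num.sqrt (h n).
Proof.
rewrite /gegen_norm; congr Num.sqrt; congr fine.
by apply: eq_integral => x _; rewrite hornerM horner_gegenp expr2.
Qed.

Lemma sqr_coefE n : coef lam u n ^+ 2 = (uL (G n) / h n) ^+ 2 * h n.
Proof.
have hn := gnorm2_gt0 lam_gt0 n.
have -> : coef lam u n = (Num.sqrt (h n))^-1 * uL (G n).
  rewrite /uL -RintegralZl//; last exact: integrable_u_poly.
  apply: eq_Rintegral => x _.
  by rewrite /cgegen gegen_normE horner_gegenp; ring.
rewrite exprMn exprVn sqr_sqrtr ?(ltW hn)//; field.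
by rewrite gt_eqF.
Qed.

(** Such a q lies in the span of C_0, ..., C_(N-1), and against each of these u and its N-th partial
    sum have the same integral. This lets u be replaced by a polynomial in terms linear in u. *)
Lemma uL_projection N q : (size q <= N)%N ->
  uL q = Lw lam (q * \sum_(n < N) (uL (G n) / h n) *: G n).
Proof.
move=> hN; have hl := half_lt_lam lam_gt0.
have qE := @gmulp_sum _ _ lam_gt0 q 0 N hN; rewrite gegenp0 mulr1 in qE.
rewrite {1}qE (uL_sum _ (fun k => gmulp lam q 0 k *: G k)).
rewrite mulr_sumr (@Lw_sum _ _ _ (fun n => q * ((uL (G n) / h n) *: G n)))//.
apply: eq_bigr => n _; rewrite uLZ -scalerAr LwZ//.
have := Lw_mul_gegenp2 lam_gt0 q 0 n; rewrite gegenp0 mulr1 => ->.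
by field; rewrite gt_eqF// gnorm2_gt0.
Qed.

(* u^2 = 2 u p - p^2 + (u - p)^2, and u may be replaced by a partial sum P of its expansion
   in the first term, where 2 P p - p^2 <= P^2. *)
Lemma hardy_rho_poly (S : R) J p :
  (forall N, \sum_(n < N) m n * coef lam u n ^+ 2 <= S) ->
  (muint lam (fun x => u x ^+ 2 * (rho J).[x])%R <=
   (Q^-1 * S)%:E + (poly_bound (rho J))%:E * L2sq lam (fun x => u x - p.[x])%R)%E.
Proof.
move=> hS; have hl := half_lt_lam lam_gt0.
have Q0 := Qconst_gt0 lam_gt0 sigma_gt0 sigma_lt1.
have s0 : 0 < sigma / 2 by rewrite divr_gt0.
pose D x := (u x - p.[x]) ^+ 2 * (rho J).[x] * weight lam x.
have i1 := integrable_u2_poly (rho J).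
have i2 := integrable_u_poly (2 *: (rho J * p)).
have i3 := integrable_poly_weight (rho J * p ^+ 2) hl.
have i4 : mu.-integrable I11 (EFin \o (fun x => u x * (2 *: (rho J * p)).[x] * weight lam x -
    (rho J * p ^+ 2).[x] * weight lam x)) by exact: integrableB_fun.
have iD : mu.-integrable I11 (EFin \o D).
  have : mu.-integrable I11 (EFin \o (fun x => u x ^+ 2 * (rho J).[x] * weight lam x -
    (u x * (2 *: (rho J * p)).[x] * weight lam x - (rho J * p ^+ 2).[x] * weight lam x))).
    exact: integrableB_fun.
  apply: eq_integrable => // x _; rewrite /D /= hornerZ !hornerM; congr EFin; ring.
have -> : muint lam (fun x => u x ^+ 2 * (rho J).[x]) =
    (uL (2 *: (rho J * p)) - Lw lam (rho J * p ^+ 2) + \int[mu]_(x in I11) D x)%:E.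
  rewrite /muint -[LHS]fineK; last exact: integrable_fin_num i1.
  congr EFin; rewrite -/(Rintegral _ _ _) /uL /Lw -RintegralB// -RintegralD//.
  by apply: eq_Rintegral => x _; rewrite /D hornerZ !hornerM; ring.
rewrite EFinD; apply: leeD; last first.
  rewrite /Rintegral fineK; last exact: integrable_fin_num iD.
  have mup : measurable_fun I11 (fun x => u x - p.[x]).
    by apply: measurable_funB => //; exact: measurable_horner.
  rewrite /L2sq /muint -ge0_integralZl//.
  - apply: ge0_le_integral => //.
    + move=> x _; rewrite lee_fin /D; apply: mulr_ge0; last exact: weight_ge0.
      by apply: mulr_ge0; [exact: sqr_ge0|exact: horner_rhop_ge0].
    + exact: measurable_int iD.
    + by apply: measurable_funeM; exact: (measurable_sqr_weight lam mup).
    + move=> x Ix; rewrite -EFinM lee_fin /D mulrA ler_wpM2r ?weight_ge0// mulrC.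
      rewrite ler_wpM2r ?sqr_ge0//.
      by apply: le_trans (horner_bound_I11 _ Ix); exact: ler_norm.
  - exact: (measurable_sqr_weight lam mup).
  - by move=> x _; rewrite lee_fin; apply: mulr_ge0; [exact: sqr_ge0|exact: weight_ge0].
  - by rewrite lee_fin poly_bound_ge0.
rewrite lee_fin uLZ (uL_projection (leqnn _)).
set N := size _; set P := \sum_(n < N) _.
have h1 : 0 <= Lw lam (rho J * (P - p) ^+ 2).
  apply: Lw_ge0 => x _; rewrite hornerM horner_exp mulr_ge0 ?sqr_ge0//.
  exact: horner_rhop_ge0.
have h2 : Lw lam (rho J * (P - p) ^+ 2) =
    Lw lam (rho J * P ^+ 2) - (2 * Lw lam (rho J * p * P) - Lw lam (rho J * p ^+ 2)).
  by rewrite -LwZ// -!LwB//; congr Lw; rewrite -mul_polyC; ring.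
have h3 : Lw lam (rho J * P ^+ 2) <= Q^-1 * S.
  rewrite ler_pdivlMl//; apply: le_trans (hS N).
  apply: (le_trans (hardy_finite_sum J N (fun n => uL (G n) / h n))).
  by apply: ler_sum => n _; rewrite sqr_coefE.
lra.
Qed.

Lemma hardy_rho (S : R) J :
  (forall N, \sum_(n < N) m n * coef lam u n ^+ 2 <= S) ->
  (muint lam (fun x => u x ^+ 2 * (rho J).[x])%R <= (Q^-1 * S)%:E)%E.
Proof.
move=> hS; apply/lee_addgt0Pr => e e0.
have b0 : 0 < poly_bound (rho J) + 1 by rewrite ltr_wpDl// poly_bound_ge0.
have [_ /(_ _ (divr_gt0 e0 b0)) [p hp]] := polynomials_dense (half_lt_lam lam_gt0) mu_ u2.
apply: (le_trans (hardy_rho_poly J p hS)); rewrite leeD2l//.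
apply: (@le_trans _ _ ((poly_bound (rho J))%:E * (e / (poly_bound (rho J) + 1))%:E)%E).
  by rewrite lee_wpmul2l// lee_fin poly_bound_ge0.
rewrite -EFinM lee_fin mulrA ler_pdivrMr//.
by have := poly_bound_ge0 (rho J); nra.
Qed.

Lemma hardy_real (S : R) :
  (forall N, \sum_(n < N) m n * coef lam u n ^+ 2 <= S) ->
  (hardy_lhs sigma lam u <= (Q^-1 * S)%:E)%E.
Proof.
move=> hS.
have s0 : 0 < sigma / 2 by rewrite divr_gt0.
have s1 : sigma / 2 <= 1 by have := sigma_lt1; lra.
have mf J : measurable_fun I11 (fun x => (u x ^+ 2 * (rho J).[x] * weight lam x)%:E).
  exact: measurable_int (integrable_u2_poly (rho J)).
have f0 J x : (0 <= (u x ^+ 2 * (rho J).[x] * weight lam x)%:E)%E.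
  rewrite lee_fin; apply: mulr_ge0; last exact: weight_ge0.
  by apply: mulr_ge0; [exact: sqr_ge0|exact: horner_rhop_ge0].
have nd x : nondecreasing_seq (fun J => (u x ^+ 2 * (rho J).[x] * weight lam x)%:E).
  move=> i j ij; rewrite lee_fin ler_wpM2r ?weight_ge0// ler_wpM2l ?sqr_ge0//.
  exact: horner_rhop_nondecreasing.
have := @cvg_monotone_convergence _ _ _ mu I11 ltac:(done)
  (fun J x => (u x ^+ 2 * (rho J).[x] * weight lam x)%:E) mf (fun J x _ => f0 J x) (fun x _ => nd x).
have -> : (\int[mu]_(x in I11) limn (fun J => (u x ^+ 2 * (rho J).[x] * weight lam x)%:E) =
    hardy_lhs sigma lam u)%E.
  apply: eq_integral => x /set_mem Ix; apply/cvg_lim => //.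
  apply: cvg_EFin; first exact: nearW.
  apply: cvgM; last exact: cvg_cst.
  apply: cvgM; first exact: cvg_cst.
  by rewrite -powRN; exact: horner_rhop_cvg.
move=> cv; rewrite -(cvg_lim _ cv)//; apply: lime_le.
  by apply/cvg_ex; eexists; exact: cv.
by apply: nearW => J; exact: hardy_rho.
Qed.

End hardy.

Theorem theorem1 (R : realType) (lam sigma : R) (u : R -> R)
  (hlam : 0 < lam) (hs0 : 0 < sigma) (hs1 : sigma < 1)
  (hu : Hsob sigma lam u) :
  ((Qconst sigma lam)%:E * hardy_lhs sigma lam u <= Aform sigma lam u)%E.
Proof.
have [[mu_ u2] _] := hu.
have t0 n : (0 <= (Amult sigma lam n * coef lam u n ^+ 2)%:E)%E.
  by rewrite lee_fin mulr_ge0 ?sqr_ge0// ltW// Amult_gt0.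
(* An infinite right side leaves nothing to prove; a finite one is itself the real bound on all
   partial sums that [hardy_real] takes. *)
have := leey (Aform sigma lam u); rewrite le_eqVlt => /predU1P[->|fin]; first exact: leey.
have A0 : (0 <= Aform sigma lam u)%E by exact: nneseries_ge0.
have fA : Aform sigma lam u \is a fin_num by rewrite ge0_fin_numE.
have Q0 := Qconst_gt0 hlam hs0 hs1.
have hS N : \sum_(n < N) Amult sigma lam n * coef lam u n ^+ 2 <= fine (Aform sigma lam u).
  rewrite -lee_fin fineK// -sumEFin.
  rewrite -(big_mkord xpredT (fun n => (Amult sigma lam n * coef lam u n ^+ 2)%:E)).
  exact: nneseries_lim_ge.
have := hardy_real hlam hs0 hs1 mu_ u2 hS.
rewrite EFinM fineK// => h.
apply: (@le_trans _ _ ((Qconst sigma lam)%:E * ((Qconst sigma lam)^-1%:E * Aform sigma lam u))%E).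
  by rewrite lee_wpmul2l// lee_fin ltW.
by rewrite muleA -EFinM divff ?gt_eqF// mul1e.
Qed.
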